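(* Let $(J_t)_{t\ge0}$, $J_t=PY_tQY_t^\star P$, be a stationary free Jacobi process with parameters $(\lambda,\theta)$, where $\lambda>0$, $\theta\in\,]0,1[$, $\lambda\theta\le1$. Then for every $t\ge0$ the law of $J_t$ in $(P\mathscr{A}P,\tilde\Phi)$ does not depend on $t$ and equals $$\mu(dx)=\max(0,1-l)\,\delta_0(dx)+\max(0,1-k)\,\delta_1(dx)+g(x)\mathbf{1}_{[x_-,x_+]}(x)\,dx,$$ where $l=1/\lambda$, $k=(1-\theta)/(\lambda\theta)$, $$x_\pm=\left(\sqrt{\theta(1-\lambda\theta)}\pm\sqrt{\lambda\theta(1-\theta)}\right)^2,\qquad g(x)=\frac{\sqrt{(x-x_-)(x_+-x)}}{2\lambda\theta\,\pi\,x(1-x)}.$$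
   Context: $(\mathscr{A},\Phi)$ is a $W^\star$ non-commutative probability space: $\mathscr{A}$ is a von Neumann algebra and $\Phi$ a faithful normal tracial state. $P,Q\in\mathscr{A}$ are projections with $\Phi(P)=\lambda\theta$, $\Phi(Q)=\theta$ and $PQ=QP=P$ if $\lambda\le1$, $PQ=QP=Q$ if $\lambda>1$. $Y_t=Y^0_tY_0$ is a free multiplicative Brownian motion started at a unitary $Y_0$: $Y^0$ is the unitary solution of $dY^0_t=i\,dX_t\,Y^0_t-\frac12Y^0_t\,dt$, $Y^0_0=1$, with $X$ a free additive Brownian motion; $\{Y^0_t,(Y^0_t)^\star:t\ge0\}$ is free from $\{P,Q\}$, and $Y_0$ is free from $Y^0$ and from $\{P,Q\}$ (with $P,Q,Y_0$ in the initial algebra of a filtration for which $X$ is a free Brownian motion). The free Jacobi process $J_t=PY_tQY_t^\star P$ lives in the compressed space $(P\mathscr{A}P,\tilde\Phi)$, $\tilde\Phi=\frac1{\lambda\theta}\Phi|_{P\mathscr{A}P}$, with unit $P$. It is called stationary when $Y_0$ is Haar distributed, i.e. $\Phi(Y_0^k)=\delta_{k0}$ for all $k\in\mathbb{Z}$; then $Y_t$ is Haar distributed for all $t$. *)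

(* Defs.v *)
From HB Require Import structures.
From mathcomp Require Import all_boot all_order all_algebra.
From mathcomp Require Import sesquilinear complex.
From mathcomp Require Import all_classical all_reals all_analysis.

Set Implicit Arguments.
Unset Strict Implicit.
Unset Printing Implicit Defensive.

Import Order.TTheory GRing.Theory Num.Theory Num.Def.
Import numFieldNormedType.Exports.

Local Open Scope classical_set_scope.
Local Open Scope ring_scope.

Section BoundedOperators.
Context (K : numFieldType) (H : normedModType K).

Definition bounded_op : {pred H -> H} :=
  fun f => `[< linear f /\ continuous f >].

Lemma bounded_opP (f : H -> H) :
  reflect (linear f /\ continuous f) (f \in bounded_op).
Proof. exact: asboolP. Qed.

Record bop := BOp { bop_fun :> H -> H; _ : bop_fun \in bounded_op }.

HB.instance Definition _ := [isSub for bop_fun].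
HB.instance Definition _ := [Choice of bop by <:].

Lemma bounded_op_submod : submod_closed bounded_op.
Proof.
split; first by apply/bounded_opP; split;
  [move=> k x y; rewrite scaler0 addr0 | exact: cst_continuous].
move=> k f g /bounded_opP[lf cf] /bounded_opP[lg cg]; apply/bounded_opP; split.
  move=> j x y; rewrite !fctE lf lg !scalerDr !scalerA [k * j]mulrC.
  by rewrite addrACA.
move=> x; apply: continuousD; last exact: cg.
by apply: continuousZl_tmp; exact: cf.
Qed.

HB.instance Definition _ :=
  GRing.isSubmodClosed.Build K (H -> H) bounded_op bounded_op_submod.
HB.instance Definition _ := [SubChoice_isSubLmodule of bop by <:].

Lemma bopP (f g : bop) : f =1 g -> f = g.
Proof. by move=> fg; apply/val_inj/funext. Qed.

Lemma bop_linear (f : bop) : linear f.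
Proof. by case: f => f /= /bounded_opP[]. Qed.

Lemma bop_continuous (f : bop) : continuous f.
Proof. by case: f => f /= /bounded_opP[]. Qed.

Lemma id_bounded_op : (id : H -> H) \in bounded_op.
Proof. by apply/bounded_opP; split=> // x; exact: cvg_id. Qed.

Lemma comp_bounded_op (f g : bop) : f \o g \in bounded_op.
Proof.
apply/bounded_opP; split=> [k x y|x] /=; first by rewrite !bop_linear.
by apply: continuous_comp; exact: bop_continuous.
Qed.

Definition bop_one := BOp id_bounded_op.
Definition bop_mul (f g : bop) := BOp (comp_bounded_op f g).

Lemma bopD (f g : bop) (x : H) : (f + g) x = f x + g x.
Proof. by []. Qed.

Lemma bopZ (k : K) (f : bop) (x : H) : (k *: f) x = k *: f x.
Proof. by []. Qed.

Lemma bop_mulA : associative bop_mul.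
Proof. by move=> f g h; apply: bopP. Qed.
Lemma bop_mul1 : left_id bop_one bop_mul.
Proof. by move=> f; apply: bopP. Qed.
Lemma bop_mulr1 : right_id bop_one bop_mul.
Proof. by move=> f; apply: bopP. Qed.
Lemma bop_mulDl : left_distributive bop_mul +%R.
Proof. by move=> f g h; apply: bopP. Qed.
Lemma bop_mulDr : right_distributive bop_mul +%R.
Proof.
move=> f g h; apply: bopP => x.
by have := bop_linear f 1 (g x) (h x); rewrite !scale1r.
Qed.

HB.instance Definition _ := GRing.Zmodule_isPzRing.Build bop
  bop_mulA bop_mul1 bop_mulr1 bop_mulDl bop_mulDr.

Lemma bop_scaleAl (k : K) (f g : bop) : k *: (f * g) = (k *: f) * g.
Proof. exact: bopP. Qed.
Lemma bop_scaleAr (k : K) (f g : bop) : k *: (f * g) = f * (k *: g).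
Proof.
apply: bopP => x; have := bop_linear f k (g x) 0.
have f0 : f 0 = 0.
  have /(congr1 (fun y => y - f 0)) := bop_linear f 1 0 0.
  by rewrite !scale1r addr0 addrK subrr.
by rewrite f0 !addr0 => fk; exact: esym fk.
Qed.

End BoundedOperators.

(* [H] with the form [dot] is a complex Hilbert space once the norm of [H] is
   the one induced by [dot]. The form is linear in its first argument. *)
Definition hilbert_norm (R : realType) (H : completeNormedModType R[i])
  (dot : {dot H for conjC}) := forall x : H, `|x| ^+ 2 = dot x x.

(* the set function f(x) 1_[lo, hi](x) dx *)
Definition density_on (R : realType) (lo hi : R) (f : R -> R)
    (B : set (measurableTypeR R)) : \bar R :=
  (\int[lebesgue_measure]_(x in B `&` `[lo, hi]) (f x)%:E)%E.

Section WstarProbabilitySpace.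
Context (R : realType) (H : completeNormedModType R[i]).
Variable dot : {dot H for conjC}.
Notation C := R[i].
Notation bop := (bop H).

Implicit Types (a b c p u : bop) (S A : set bop) (Phi : bop -> C).

Definition is_adjoint a b := forall x y : H, dot (a x) y = dot x (b y).

(* The adjoint is unique, and it exists by Riesz representation; the default
   value 0 is never taken on the algebras below, which contain an adjoint of
   each of their elements. *)
Definition star a : bop := xget 0 [set b | is_adjoint a b].

Definition commutant S : set bop := [set b | forall a, S a -> a * b = b * a].

Definition star_closed S := forall a, S a -> exists2 b, S b & is_adjoint a b.

Definition von_neumann_algebra A :=
  star_closed A /\ commutant (commutant A) = A.

Definition op_le a b := forall x : H, 0 <= dot ((b - a) x) x.

Definition op_directed S := forall a b, S a -> S b ->
  exists2 c, S c & op_le a c /\ op_le b c.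

Definition op_lub S a := (forall b, S b -> op_le b a) /\
  (forall c, star c = c -> (forall b, S b -> op_le b c) -> op_le a c).

Record faithful_normal_tracial_state A Phi : Prop := {
  state_add : forall a b, A a -> A b -> Phi (a + b) = Phi a + Phi b ;
  state_scale : forall (k : C) a, A a -> Phi (k *: a) = k * Phi a ;
  state_one : Phi 1 = 1 ;
  state_ge0 : forall a, A a -> 0 <= Phi (star a * a) ;
  state_faithful : forall a, A a -> Phi (star a * a) = 0 -> a = 0 ;
  state_tracial : forall a b, A a -> A b -> Phi (a * b) = Phi (b * a) ;
  (* [Phi] preserves suprema of bounded upward directed families of
     self-adjoint elements; [Phi b <= Phi a] for [b] in [S] is positivity *)
  state_normal : forall S a, S !=set0 -> S `<=` A ->
    (forall b, S b -> star b = b) -> op_directed S -> A a -> op_lub S a ->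
    forall c : C, (forall b, S b -> Phi b <= c) -> Phi a <= c }.

Definition projection p := star p = p /\ p * p = p.

Definition unitary u := star u * u = 1 /\ u * star u = 1.

(* unital star-subalgebras *)
Record star_subalgebra S : Prop := {
  subalg_one : S 1 ;
  subalg_add : forall a b, S a -> S b -> S (a + b) ;
  subalg_scale : forall (k : C) a, S a -> S (k *: a) ;
  subalg_mul : forall a b, S a -> S b -> S (a * b) ;
  subalg_star : star_closed S }.

Definition generated_algebra S : set bop :=
  [set a | forall B : set bop, star_subalgebra B -> S `<=` B -> B a].

Definition free_family Phi (I : eqType) (S : I -> set bop) :=
  forall w : seq (I * bop), (0 < size w)%N ->
    sorted (fun u v : I * bop => u.1 != v.1) w ->
    (forall u : I * bop, u \in w ->
       generated_algebra (S u.1) u.2 /\ Phi u.2 = 0) ->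
    Phi (\prod_(u <- w) u.2) = 0.

Definition freely_independent Phi S1 S2 :=
  free_family Phi (fun i : bool => if i then S1 else S2).

(* Law of [a] in a corner with unit [e] and state [phi]: the compactly
   supported probability measure with the moments of [a]. The factor [e] only
   matters in degree 0, where the power of [a] in the corner is [e]. *)
Definition has_law (phi : bop -> C) (e a : bop)
    (mu : probability (measurableTypeR R) R) :=
  (exists M : R, mu `[- M, M]%classic = 1%E) /\
  (forall n : nat, phi (e * a ^+ n) = (\int[mu]_x (x ^+ n))%R%:C%C).

Definition semicircle_pdf (v x : R) : R :=
  Num.sqrt (4 * v - x ^+ 2) / (2 * pi * v).

Definition semicircular Phi a (v : R) :=
  exists mu : probability (measurableTypeR R) R,
    (forall B : set (measurableTypeR R), measurable B ->
       mu B = density_on (- (2 * Num.sqrt v)) (2 * Num.sqrt v)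
                (semicircle_pdf v) B)
    /\ has_law Phi 1 a mu.

Definition haar_unitary Phi u := unitary u /\
  forall k : int,
    Phi (match k with Posz n => u ^+ n | Negz n => star u ^+ n.+1 end)
    = (k == 0)%:R.

(* Processes are indexed by [R]; only their values at times >= 0 matter. *)
Implicit Types (F : R -> set bop) (X Z U : R -> bop).

Definition filtration A F :=
  (forall t : R, 0 <= t -> von_neumann_algebra (F t) /\ F t `<=` A) /\
  (forall s t : R, 0 <= s -> s <= t -> F s `<=` F t).

Record free_brownian_motion Phi F X : Prop := {
  fbm_start : X 0 = 0 ;
  fbm_adapted : forall t : R, 0 <= t -> F t (X t) ;
  fbm_selfadjoint : forall t : R, 0 <= t -> star (X t) = X t ;
  fbm_free : forall s t : R, 0 <= s -> s < t ->
    freely_independent Phi (F s) [set X t - X s] ;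
  fbm_semicircular : forall s t : R, 0 <= s -> s < t ->
    semicircular Phi (X t - X s) (t - s) }.

(* the step process equal to [sp_val i] on [[sp_time i, sp_time i.+1[ *)
Record simple_process := SimpleProcess {
  sp_size : nat ;
  sp_time : nat -> R ;
  sp_val : nat -> bop }.

Definition adapted_simple F (t : R) (V : simple_process) :=
  [/\ sp_time V 0%N = 0, sp_time V (sp_size V) = t &
    forall i, (i < sp_size V)%N -> sp_time V i <= sp_time V i.+1 /\
      F (sp_time V i) (sp_val V i)].

Definition simple_eval (V : simple_process) (s : R) : bop :=
  \sum_(i < sp_size V)
    if sp_time V i <= s < sp_time V i.+1 then sp_val V i else 0.

Definition simple_integral Z (V : simple_process) : bop :=
  \sum_(i < sp_size V) (Z (sp_time V i.+1) - Z (sp_time V i)) * sp_val V i.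

Definition sqnorm2 Phi a : R := complex.Re (Phi (star a * a)).

(* [J] is the integral of [dZ_s U_s] over [0, t], as an L^2 limit of integrals
   of adapted simple processes. For a free Brownian motion [Z = X] this is the
   free stochastic integral (well defined by the free Ito isometry), and for
   [Z s = s%:C *: 1] the integral of [U_s ds]. *)
Definition integral_process Phi F Z U (t : R) (J : bop) :=
  exists V : nat -> simple_process,
    let T := `[0, t]%classic : set (measurableTypeR R) in
    let err n (s : measurableTypeR R) :=
      sqnorm2 Phi (U s - simple_eval (V n) s) in
    [/\ forall n, adapted_simple F t (V n),
      forall n, measurable_fun T (err n),
      (\int[lebesgue_measure]_(s in T) (err n s)%:E)%E
         @[n --> \oo] --> 0%E &
      sqnorm2 Phi (J - simple_integral Z (V n)) @[n --> \oo] --> 0].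

(* unitary solution of dU_t = i dX_t U_t - U_t dt / 2, U_0 = 1 *)
Record free_multiplicative_brownian_motion A Phi F X U : Prop := {
  fmbm_start : U 0 = 1 ;
  fmbm_adapted : forall t : R, 0 <= t -> F t (U t) ;
  fmbm_unitary : forall t : R, 0 <= t -> unitary (U t) ;
  fmbm_sde : forall t : R, 0 <= t -> exists J D : bop,
    [/\ A J /\ A D, integral_process Phi F X U t J,
      integral_process Phi F (fun s => s%:C%C *: (1 : bop)) U t D &
      U t = 1 + ('i%C : C) *: J - (2^-1 : C) *: D] }.

End WstarProbabilitySpace.

Section StationaryLaw.
Context (R : realType).
Implicit Types lambda theta : R.

Definition jacobi_xm lambda theta : R :=
  (Num.sqrt (theta * (1 - lambda * theta)) -
   Num.sqrt (lambda * theta * (1 - theta))) ^+ 2.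

Definition jacobi_xp lambda theta : R :=
  (Num.sqrt (theta * (1 - lambda * theta)) +
   Num.sqrt (lambda * theta * (1 - theta))) ^+ 2.

Definition jacobi_pdf lambda theta (x : R) : R :=
  Num.sqrt ((x - jacobi_xm lambda theta) * (jacobi_xp lambda theta - x)) /
  (2 * lambda * theta * pi * x * (1 - x)).

Definition jacobi_measure lambda theta (B : set (measurableTypeR R)) : \bar R :=
  let l : R := 1 / lambda in
  let k : R := (1 - theta) / (lambda * theta) in
  ((Num.max 0 (1 - l))%R%:E * dirac (0%R : measurableTypeR R) B +
   (Num.max 0 (1 - k))%R%:E * dirac (1%R : measurableTypeR R) B +
   density_on (jacobi_xm lambda theta) (jacobi_xp lambda theta)
     (jacobi_pdf lambda theta) B)%E.

End StationaryLaw.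

(* Main.v *)
Require Import Defs.
From HB Require Import structures.
From mathcomp Require Import all_boot all_order all_algebra.
From mathcomp Require Import sesquilinear complex.
From mathcomp Require Import all_classical all_reals all_analysis measurable_realfun.
From mathcomp Require Import ring lra.

Set Implicit Arguments.
Unset Strict Implicit.
Unset Printing Implicit Defensive.

Import Order.TTheory GRing.Theory Num.Theory Num.Def.
Import numFieldNormedType.Exports.

Local Open Scope classical_set_scope.
Local Open Scope ring_scope.

(* Writing [a = lambda * theta] and [b = theta], conjugate [J_t] by [Y0 t = U]:
   up to this conjugation [J_t] is [p q p] with [p = U^* P U] and
   [q = V Q V^*], [V = Yinit]. Since [V] is Haar and free from [U], [P], [Q],
   the words alternating in [q - b = V (Q - b) V^*] and [p - a = U^* (P - a) U]
   have trace 0; nothing else about the Brownian motion matters.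
   Hence the corner words [p (q - b) (p - a) (q - b) ... (q - b) p] have trace
   0. They are polynomials [K_n] in [p q p] satisfying a three-term recursion
   with constant coefficients, and this determines all the moments of [J_t].
   It remains to see that the measure [mu] of the statement has mass 1 and
   annihilates every [K_n], [n > 0]. By partial fractions its density is a
   combination of the semicircle function [w] divided by [x] and by [1 - x], and
   [K_n] is a combination of three consecutive Chebyshev polynomials [V_n] of the
   support. The integrals of [V_n w / (z - x)] follow from the orthogonality of
   the [V_n] to 1 with respect to [w], and from their slow growth. *)

(** * Semicircle integrals *)

Section Chebyshev.
Context (R : realType).
Implicit Types c s : R.

(** The monic polynomials [s^n U_n((x - c) / (2 s))], with [U_n] the second-kind Chebyshev
    polynomials, adapted to [[c - 2 s, c + 2 s]]. *)
Fixpoint chebyshev c s n : {poly R} :=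
  if n is n'.+1 then
    if n' is n''.+1 then
      ('X - c%:P) * chebyshev c s n' - (s ^+ 2) *: chebyshev c s n''
    else 'X - c%:P
  else 1.

Lemma chebyshev0 c s x : (chebyshev c s 0).[x] = 1.
Proof. by rewrite /= hornerE. Qed.

Lemma chebyshev1 c s x : (chebyshev c s 1).[x] = x - c.
Proof. by rewrite /= !hornerE. Qed.

Lemma chebyshevSS c s n x : (chebyshev c s n.+2).[x] =
  (x - c) * (chebyshev c s n.+1).[x] - s ^+ 2 * (chebyshev c s n).[x].
Proof. by rewrite /= !hornerE. Qed.

(** Unnormalised, of mass [2 * pi * s ^+ 2]; it vanishes off the interval because [Num.sqrt] is 0 on
    negative numbers. *)
Definition semicircle c s (x : R) : R := Num.sqrt (4 * s ^+ 2 - (x - c) ^+ 2).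

Lemma semicircle_cos c s t : 0 <= s -> 0 <= t <= pi ->
  semicircle c s (c + 2 * s * cos t) = 2 * s * sin t.
Proof.
move=> s0 t0; rewrite /semicircle.
have -> : 4 * s ^+ 2 - (c + 2 * s * cos t - c) ^+ 2 = (2 * s * sin t) ^+ 2.
  by rewrite [RHS]exprMn sin2cos2; ring.
by rewrite sqrtr_sqr ger0_norm// mulr_ge0 ?sin_ge0_pi// mulr_ge0.
Qed.

Lemma chebyshev_cos c s n t :
  (chebyshev c s n).[c + 2 * s * cos t] * sin t = s ^+ n * sin (n.+1%:R * t).
Proof.
elim/ltn_ind: n => -[|[|n]] IH.
- by rewrite chebyshev0 expr0 !mul1r.
- by rewrite chebyshev1 (mulr_natl t) sin_mulr2n expr1 mulr2n; ring.
- set y := c + 2 * s * cos t in IH *; rewrite chebyshevSS mulrBl.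
  rewrite -(mulrA (y - c)) -(mulrA (s ^+ 2)) IH// IH// /y.
  have -> : n.+3%:R * t = n.+2%:R * t + t by rewrite [n.+3%:R]mulrSr mulrDl mul1r.
  have -> : n.+1%:R * t = n.+2%:R * t - t.
    by rewrite [n.+2%:R]mulrSr mulrDl mul1r addrK.
  by rewrite sinB sinD !exprS; ring.
Qed.

(* Each step of the recursion multiplies the quadratic form
   [V_{n+1}^2 - (x - c) V_{n+1} V_n + s^2 V_n^2] by [s^2]; the identity below is
   4 times this, after completing the square. *)
Lemma chebyshev_norm c s n x :
  (2 * (chebyshev c s n.+1).[x] - (x - c) * (chebyshev c s n).[x]) ^+ 2 +
  (4 * s ^+ 2 - (x - c) ^+ 2) * (chebyshev c s n).[x] ^+ 2 =
  4 * (s ^+ 2) ^+ n.+1.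
Proof.
elim: n => [|n IH]; first by rewrite chebyshev1 chebyshev0; ring.
by rewrite chebyshevSS (exprS (s ^+ 2) n.+1) [RHS]mulrCA -IH; ring.
Qed.

(** Dropping the first square in [chebyshev_norm] bounds the square of the left side. *)
Lemma semicircle_chebyshev_le c s n x : 0 <= s -> `|x - c| <= 2 * s ->
  `|(chebyshev c s n).[x] * semicircle c s x| <= 2 * s ^+ n.+1.
Proof.
move=> s0 xD.
rewrite -(@ler_pXn2r _ 2)// ?nnegrE ?mulr_ge0 ?exprn_ge0//.
rewrite real_normK ?num_real// exprMn /semicircle sqr_sqrtr; last first.
  rewrite -(real_normK (num_real (x - c))).
  rewrite (_ : 4 * _ = (2 * s) ^+ 2); last by ring.
  by rewrite subr_ge0 ler_pXn2r// nnegrE mulr_ge0.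
rewrite [leRHS](_ : _ = 4 * (s ^+ 2) ^+ n.+1); last by rewrite exprMn exprAC; ring.
by rewrite -(chebyshev_norm c s n x) [leLHS]mulrC lerDr sqr_ge0.
Qed.

End Chebyshev.

(** * Orthogonality of the Chebyshev polynomials to 1 for the semicircle function *)

Section SemicircleIntegrals.
Context (R : realType) (c s : R).
Hypothesis s0 : 0 < s.
Notation mu := (@lebesgue_measure R).
Notation D := (`[(c - 2 * s)%R, (c + 2 * s)%R]%classic : set R).
Notation w := (semicircle c s).
Notation V := (chebyshev c s).

Lemma continuous_semicircle : continuous w.
Proof.
move=> x; apply: continuous_comp; last exact: sqrt_continuous.
apply: cvgB; first exact: cvg_cst.
under eq_fun do rewrite expr2.
by rewrite expr2; apply: cvgM; apply: cvgB => //; exact: cvg_cst.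
Qed.

Lemma derive_angle (t : R) :
  is_derive t 1 (fun t : R => c + 2 * s * cos t) (- (2 * s * sin t)).
Proof.
apply: is_derive_eq.
by rewrite add0r mul1r /GRing.scale /= mulrN.
Qed.

Lemma derivable_continuous (f : R -> R) (x d : R) :
  is_derive x 1 f d -> {for x, continuous f}.
Proof.
by move=> df; apply/differentiable_continuous/derivable1_diffP/ex_derive.
Qed.

Lemma derivable_LRcontinuous (f f' : R -> R) (a b : R) :
  (forall x : R, is_derive x 1 f (f' x)) -> derivable_oo_LRcontinuous f a b.
Proof.
move=> df; split=> [x _||]; first exact: ex_derive.
- by apply: cvg_at_right_filter; exact: (derivable_continuous (df a)).
- by apply: cvg_at_left_filter; exact: (derivable_continuous (df b)).
Qed.

(** Under the decreasing substitution [x = c + 2 s cos t], both [w] and minus the derivative become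
    [2 s sin t], whence the square. *)
Lemma integral_angle (f : R -> R) : continuous f ->
  \int[mu]_(x in D) (f x * w x) =
  \int[mu]_(t in `[0, pi]) (f (c + 2 * s * cos t) * (2 * s * sin t) ^+ 2).
Proof.
move=> cf; congr fine; pose F (t : R) : R := c + 2 * s * cos t.
have dF (t : R) : is_derive t 1 F (- (2 * s * sin t)) by exact: derive_angle.
have dFE : (derive1 F) = fun t => - (2 * s * sin t).
  by apply/funext => t; rewrite derive1E; exact: derive_val.
have cdF : continuous (derive1 F).
  move=> t; rewrite dFE; apply: cvgN; apply: cvgM; first exact: cvg_cst.
  exact: continuous_sin.
have F0 : F 0 = c + 2 * s by rewrite /F cos0 mulr1.
have Fpi : F pi = c - 2 * s by rewrite /F cospi mulrN1.
have := @integration_by_substitution_decreasing R F (fun x => f x * w x) 0 pi.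
rewrite F0 Fpi => ->.
- apply: eq_integral => t; rewrite inE/= in_itv/= => t0; congr (_%:E).
  rewrite !fctE dFE opprK /F semicircle_cos ?(ltW s0)//; ring.
- exact: pi_ge0.
- move=> x y xpi ypi xy; rewrite /F ltrD2l ltr_pM2l ?mulr_gt0//.
  by rewrite ltr_cos.
- by move=> t _; exact: cdF.
- by apply/cvg_ex; exists ((derive1 F) 0); apply: cvg_at_right_filter; exact: cdF.
- by apply/cvg_ex; exists ((derive1 F) pi); apply: cvg_at_left_filter; exact: cdF.
- exact: derivable_LRcontinuous dF.
- apply: continuous_subspaceT => x; apply: cvgM; first exact: cf.
  exact: continuous_semicircle.
Qed.

Lemma sin_natpi n : sin (n%:R * pi) = 0 :> R.
Proof.
elim: n => [|n IH]; first by rewrite mul0r sin0.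
by rewrite mulrSr mulrDl mul1r sinDpi IH oppr0.
Qed.

(** By [chebyshev_cos] the integrand is a multiple of [sin ((n + 1) t) sin t], a difference of the
    cosines of [n t] and [(n + 2) t]; over [[0, pi]] only a constant cosine contributes. *)
Lemma integral_chebyshev_semicircle n :
  \int[mu]_(x in D) ((V n).[x] * w x) = (n == 0)%:R * (2 * pi * s ^+ 2).
Proof.
rewrite integral_angle; last by exact: continuous_horner.
pose f (t : R) : R := 2 * s ^+ n.+2 * (cos (n%:R * t) - cos (n.+2%:R * t)).
(* An antiderivative of [cos (n t)]; [n = 0] stands apart since [0^-1 = 0] would make it the zero
   function. *)
pose G (t : R) : R := if n is 0 then t else n%:R^-1 * sin (n%:R * t).
pose F (t : R) : R := 2 * s ^+ n.+2 * (G t - n.+2%:R^-1 * sin (n.+2%:R * t)).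
have dsin (m : nat) (t : R) : (0 < m)%N ->
    is_derive t 1 (fun t : R => m%:R^-1 * sin (m%:R * t)) (cos (m%:R * t) : R).
  move=> m0; apply: is_derive_eq.
  by rewrite /GRing.scale /= mulr1 mulrCA mulVf ?mulr1// pnatr_eq0 -lt0n.
have dG (t : R) : is_derive t 1 G (cos (n%:R * t)).
  rewrite /G; case: (n) => [|m]; last exact: dsin.
  by rewrite mul0r cos0; exact: is_derive_id.
have dF (t : R) : is_derive t 1 F (f t).
  have dm := dsin n.+2 t isT.
  by apply: is_derive_eq.
have cf : continuous f.
  move=> t; apply: cvgM; first exact: cvg_cst.
  by apply: cvgB; apply: continuous_comp; do ?[exact: continuous_cos];
    apply: cvgM => //; exact: cvg_cst.
transitivity (\int[mu]_(t in `[0, pi]) f t).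
  apply: eq_Rintegral => t _.
  rewrite (_ : _ * _ = 4 * s ^+ 2 * sin t *
    ((V n).[c + 2 * s * cos t] * sin t)); last by ring.
  rewrite chebyshev_cos /f.
  have -> : n%:R * t = n.+1%:R * t - t by rewrite -natr1 mulrDl mul1r addrK.
  have -> : n.+2%:R * t = n.+1%:R * t + t by rewrite -[n.+2%:R]natr1 mulrDl mul1r.
  rewrite cosB cosD !exprS; ring.
rewrite /Rintegral (@continuous_FTC2 _ f F) ?pi_gt0//=; last 3 first.
- exact: continuous_subspaceT.
- exact: derivable_LRcontinuous dF.
- by move=> t _; rewrite derive1E; exact: derive_val.
rewrite /F sin_natpi !mulr0 sin0 !mulr0 !subr0 /G; case: (n) => [|m] /=.
  by rewrite mulr0 subr0 mul1r; ring.
by rewrite sin_natpi !mulr0 sin0 !mulr0 subr0 mul0r.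
Qed.

End SemicircleIntegrals.

(** * Chebyshev moments of the semicircle function divided by an affine function *)

Section SemicircleTransform.
Context (R : realType) (c s : R).
Hypothesis s0 : 0 < s.
Notation mu := (@lebesgue_measure R).
Notation D := (`[(c - 2 * s)%R, (c + 2 * s)%R]%classic : set R).
Notation w := (semicircle c s).
Notation V := (chebyshev c s).

Lemma integrable_hornerM (g : R -> R) (p : {poly R}) :
  mu.-integrable D (EFin \o g) -> mu.-integrable D (fun x => (p.[x] * g x)%:E).
Proof.
move=> ig; pose h : R -> R := horner p.
have -> : (fun x => (p.[x] * g x)%:E) = ((EFin \o h) \* (EFin \o g))%E.
  by apply/funext => x; rewrite EFinM.
apply: integrableMr => //.
- exact: measurable_poly.
- have : compact (h @` D).
    apply: continuous_compact; last exact: segment_compact.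
    by apply: continuous_subspaceT; exact: continuous_horner.
  move=> /compact_bounded[M [Mr HM]]; exists M; split => // x Mx y Dy.
  by apply: (HM _ Mx); exists y.
Qed.

(* [g] is the semicircle density divided by [zeta - e (x - c)], extended
   arbitrarily where this affine function vanishes. *)
Lemma chebyshev_moments_rec (e zeta : R) (g : R -> R)
    (h := fun n => \int[mu]_(x in D) ((V n).[x] * g x)) :
  mu.-integrable D (EFin \o g) ->
  (forall x, D x -> (zeta - e * (x - c)) * g x = w x) ->
  zeta * h 0%N - e * h 1%N = 2 * pi * s ^+ 2 /\
  forall n, zeta * h n.+1 = e * (h n.+2 + s ^+ 2 * h n).
Proof.
move=> ig gw.
have ip p : mu.-integrable D (fun x => (p.[x] * g x)%:E).
  exact: integrable_hornerM.
pose I (p : {poly R}) := \int[mu]_(x in D) (p.[x] * g x).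
have IZ k p : I (k *: p) = k * I p.
  rewrite -(RintegralZl k _ (ip p))//; apply: eq_Rintegral => x _.
  by rewrite hornerZ mulrA.
have ID p q : I (p + q) = I p + I q.
  rewrite -(RintegralD _ (ip p) (ip q))//; apply: eq_Rintegral => x _.
  by rewrite hornerD mulrDl.
have E n : I (zeta *: V n + - e *: (('X - c%:P) * V n)) =
    (n == 0%N)%:R * (2 * pi * s ^+ 2).
  rewrite -(integral_chebyshev_semicircle c s0); apply: eq_Rintegral => x.
  rewrite inE => Dx; rewrite -gw// hornerD !hornerZ hornerM hornerXsubC.
  by rewrite [RHS]mulrCA; ring.
split.
  by have := E 0%N; rewrite eqxx mul1r => <-; rewrite ID !IZ mulr1 mulNr.
move=> n; have := E n.+1; rewrite mul0r ID !IZ.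
rewrite (_ : _ * V n.+1 = V n.+2 + s ^+ 2 *: V n); last by rewrite /= subrK.
by rewrite ID IZ => /eqP; rewrite mulNr subr_eq0 => /eqP.
Qed.

(** Up to the sign [e], this is [w / (z - x)] with pole [z = c + e (v + s^2 / v)]; [e = 1] or [-1]
    selects the side of the pole. In the parameter [v] in []0, s]] the integral is simply
    [2 * pi * v]. *)
Definition semicircle_kernel (e v x : R) : R :=
  w x / (v + s ^+ 2 / v - e * (x - c)).

(** The minimum over the interval is at an endpoint, where the value is [v + s^2 / v - 2 s]. *)
Lemma semicircle_denominator (e v : R) x : `|e| = 1 -> 0 < v -> D x ->
  (s - v) ^+ 2 / v <= v + s ^+ 2 / v - e * (x - c).
Proof.
move=> e1 v0 /=; rewrite in_itv/= => xD.
have : `|e * (x - c)| <= 2 * s by rewrite normrM e1 mul1r ler_distlC addrC; lra.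
rewrite ler_norml => /andP[_ H].
rewrite (_ : (s - v) ^+ 2 / v = v + s ^+ 2 / v - 2 * s); first by lra.
by field; rewrite gt_eqF.
Qed.

Lemma semicircle_kernel_ge0 (e v : R) x : `|e| = 1 -> 0 < v -> D x ->
  0 <= semicircle_kernel e v x.
Proof.
move=> e1 v0 xD; apply: divr_ge0; first exact: sqrtr_ge0.
by apply: le_trans (semicircle_denominator e1 v0 xD); rewrite divr_ge0 ?sqr_ge0// ltW.
Qed.

(** A zero denominator, where the quotient is 0 by convention, forces [v = s] and [x = c + 2 e s];
    there [w] vanishes as well. *)
Lemma semicircle_kernelE (e v : R) x : `|e| = 1 -> 0 < v -> D x ->
  (v + s ^+ 2 / v - e * (x - c)) * semicircle_kernel e v x = w x.
Proof.
move=> e1 v0 xD; rewrite /semicircle_kernel.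
have [z0|?] := eqVneq (v + s ^+ 2 / v - e * (x - c)) 0; last first.
  by rewrite mulrCA mulfV ?mulr1.
rewrite z0 mul0r; apply/esym/eqP; rewrite /semicircle sqrtr_eq0.
have := semicircle_denominator e1 v0 xD; rewrite z0 ler_pdivrMr// mul0r => H.
have sv : v = s by apply/eqP; rewrite eq_sym -subr_eq0 -sqrf_eq0 eq_le H sqr_ge0.
have ee : e * e = 1 by rewrite -expr2 -(real_normK (num_real e)) e1 expr1n.
have {}z0 : e * (x - c) = 2 * s.
  by move: z0; rewrite sv expr2 mulfK ?gt_eqF//; lra.
have -> : (x - c) ^+ 2 = (2 * s) ^+ 2 by rewrite -z0 exprMn (expr2 e) ee mul1r.
by rewrite exprMn -natrX subrr.
Qed.

Lemma continuous_semicircle_kernel (e v : R) : `|e| = 1 -> 0 < v < s ->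
  {within D, continuous (semicircle_kernel e v)}.
Proof.
move=> e1 /andP[v0 vs]; apply: continuous_in_subspaceT => x; rewrite inE => xD.
have dx : v + s ^+ 2 / v - e * (x - c) != 0.
  rewrite gt_eqF// (lt_le_trans _ (semicircle_denominator e1 v0 xD))//.
  by rewrite divr_gt0// exprn_gt0// subr_gt0.
apply: cvgM; first exact: continuous_semicircle.
apply: cvgV => //; apply: cvgB; first exact: cvg_cst.
by apply: cvgM; [exact: cvg_cst|apply: cvgB => //; exact: cvg_cst].
Qed.

Lemma integrable_semicircle_kernel_lt (e v : R) : `|e| = 1 -> 0 < v < s ->
  mu.-integrable D (EFin \o semicircle_kernel e v).
Proof.
move=> e1 vs; apply: continuous_compact_integrable; first exact: segment_compact.
exact: continuous_semicircle_kernel.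
Qed.

(* With [u = e v], the sequence [h n.+1 - u * h n] is geometric of ratio
   [s ^+ 2 / u], while [h] grows at most like [s ^+ n]. *)
Lemma integral_semicircle_kernel_lt (e v : R) : `|e| = 1 -> 0 < v < s ->
  \int[mu]_(x in D) semicircle_kernel e v x = 2 * pi * v.
Proof.
move=> e1 vs; have /andP[v0 v_lt] := vs.
have ee : e * e = 1 by rewrite -expr2 -(real_normK (num_real e)) e1 expr1n.
have ig := integrable_semicircle_kernel_lt e1 vs.
pose h n := \int[mu]_(x in D) ((V n).[x] * semicircle_kernel e v x).
have [h0 hS] := chebyshev_moments_rec ig (fun x => semicircle_kernelE e1 v0 (x := x)).
rewrite -/(h 0%N) -/(h 1%N) in h0.
have {}hS n : (v + s ^+ 2 / v) * h n.+1 = e * (h n.+2 + s ^+ 2 * h n) by exact: hS.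
have vn0 : v != 0 by rewrite gt_eqF.
have sn0 : s != 0 by rewrite gt_eqF.
pose d := h 1%N - e * v * h 0%N.
have geo n : h n.+1 - e * v * h n = (e * (s ^+ 2 / v)) ^+ n * d.
  elim: n => [|n IH]; first by rewrite mul1r.
  rewrite (exprS _ n) -[RHS]mulrA -IH.
  have -> : h n.+2 = e * (v + s ^+ 2 / v) * h n.+1 - s ^+ 2 * h n.
    by rewrite -mulrA hS mulrA ee mul1r addrK.
  rewrite mulrBr [X in _ = _ - X](_ : _ = e * e * (s ^+ 2 / v * v * h n)); last by ring.
  by rewrite ee mul1r divfK//; ring.
(* [2 * s] comes from [semicircle_chebyshev_le], its divisor bounds the denominator of the kernel
   from below, and the last factor is the length of [D]. *)
pose K := 2 * s / ((s - v) ^+ 2 / v) * fine (mu D).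
have hle n : `|h n| <= K * s ^+ n.
  have ih := integrable_hornerM (V n) ig.
  apply: le_trans (le_normr_Rintegral _ ih) _ => //.
  rewrite [leRHS](_ : _ = \int[mu]_(x in D) (2 * s / ((s - v) ^+ 2 / v) * s ^+ n)).
    apply: le_Rintegral => //.
    - exact: integrable_norm ih.
    - apply: continuous_compact_integrable; first exact: segment_compact.
      by apply: continuous_subspaceT => x; exact: cvg_cst.
    - move=> x xD; have dpos : 0 < (s - v) ^+ 2 / v.
        by rewrite divr_gt0// exprn_gt0// subr_gt0.
      have dle := semicircle_denominator e1 v0 xD.
      rewrite mulrA normrM normfV [`|_ - e * _|]gtr0_norm ?(lt_le_trans dpos)//.
      rewrite [leRHS]mulrAC; apply: ler_pM => //; rewrite ?normr_ge0//.
      + by rewrite invr_ge0 (le_trans (ltW dpos)).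
      + rewrite -mulrA -exprS; apply: semicircle_chebyshev_le; first exact: ltW.
        by move: xD; rewrite /= in_itv/= ler_distlC; lra.
      + by rewrite lef_pV2 ?posrE// (lt_le_trans dpos).
  by rewrite Rintegral_cst// /K mulrAC.
(* The growth [s^n] against the ratio [s^2 / v] yields [|d| <= K (s + v) (v / s)^n] for every
   [n]. *)
have d0 : d = 0.
  have rlt : `|v / s| < 1.
    by rewrite ger0_norm ?divr_ge0 ?ltW// ltr_pdivrMr// mul1r.
  have rn n : `|d| <= K * (s + v) * (v / s) ^+ n.
    have : `|(e * (s ^+ 2 / v)) ^+ n * d| <= K * s ^+ n * (s + v).
      rewrite -geo; apply: le_trans (ler_normB _ _) _.
      rewrite mulrDr lerD//; first by rewrite -mulrA -exprSr.
      rewrite !normrM e1 mul1r (gtr0_norm v0) mulrC.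
      by rewrite ler_wpM2r// ltW.
    rewrite normrM normrX normrM e1 mul1r ger0_norm; last by rewrite divr_ge0 ?sqr_ge0 ?ltW.
    rewrite -ler_pdivlMl ?exprn_gt0 ?divr_gt0 ?exprn_gt0// => /le_trans; apply.
    rewrite le_eqVlt; apply/orP; left; apply/eqP.
    rewrite -exprVn invf_div !expr_div_n exprAC.
    have sn : s ^+ n != 0 by rewrite expf_neq0.
    by field.
  have cv : (fun n => K * (s + v) * (v / s) ^+ n) @ \oo --> (0 : R).
    rewrite -[X in _ --> X](mulr0 (K * (s + v))).
    by apply: cvgM; [exact: cvg_cst|exact: cvg_expr].
  apply/eqP; rewrite -normr_le0 -(cvg_lim _ cv)//.
  by apply: limr_ge; [exact: cvgP cv|near=> n; exact: rn].
have h1 : h 1%N = e * v * h 0%N by apply/eqP; rewrite -subr_eq0; exact/eqP.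
have : s ^+ 2 / v * h 0%N = 2 * pi * s ^+ 2.
  by rewrite -h0 h1 mulrA mulrA ee mul1r mulrDl addrAC subrr add0r.
move=> /(congr1 (fun y => v / s ^+ 2 * y)).
rewrite mulrA [_ / _ * (_ / _)](_ : _ = 1); last by field; rewrite vn0.
rewrite mul1r (_ : _ * (2 * _ * _) = 2 * pi * v); last by field.
move=> <-; apply: eq_Rintegral => x _.
by rewrite chebyshev0 mul1r.
Unshelve. all: by end_near. Qed.

(** [v + s^2 / v] decreases on []0, s]], and the denominators with it. *)
Lemma semicircle_kernel_nd (e v1 v2 : R) x : `|e| = 1 -> 0 < v1 ->
  v1 <= v2 -> v2 < s -> D x -> semicircle_kernel e v1 x <= semicircle_kernel e v2 x.
Proof.
move=> e1 v10 v12 v2s xD; have v20 := lt_le_trans v10 v12.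
have dpos : 0 < v2 + s ^+ 2 / v2 - e * (x - c).
  apply: lt_le_trans (semicircle_denominator e1 v20 xD).
  by rewrite divr_gt0// exprn_gt0// subr_gt0.
have dle : v2 + s ^+ 2 / v2 <= v1 + s ^+ 2 / v1.
  rewrite -subr_ge0 (_ : _ - _ = (v2 - v1) * ((s * s - v1 * v2) / (v1 * v2))).
    apply: mulr_ge0; first by rewrite subr_ge0.
    apply: divr_ge0; last by rewrite mulr_ge0 ?ltW.
    by rewrite subr_ge0 ler_pM ?ltW// (le_lt_trans v12).
  by field; rewrite !gt_eqF.
apply: ler_wpM2l; first exact: sqrtr_ge0.
by rewrite lef_pV2 ?posrE ?lerD2r// (lt_le_trans dpos)// lerD2r.
Qed.

(** Since [harmonic k] is [1 / (k + 1)], the factor [1 / 2] keeps the first term positive. *)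
Let approach (k : nat) : R := s * (1 - harmonic k / 2).

Let approach_itv k : 0 < approach k < s.
Proof.
have h0 : 0 < (harmonic k : R) by exact: harmonic_gt0.
have h1 : (harmonic k : R) <= 1 by rewrite /= invf_le1// ler1n.
apply/andP; split; first by apply: mulr_gt0 => //; lra.
by rewrite -[ltRHS]mulr1 ltr_pM2l//; lra.
Qed.

Let approach_nd : {homo approach : m n / (m <= n)%N >-> m <= n}.
Proof.
move=> m n mn; rewrite /approach ler_pM2l// lerD2l lerN2 ler_pM2r//.
by rewrite /= lef_pV2 ?posrE// ler_nat ltnS.
Qed.

Let approach_cvg : approach @ \oo --> s.
Proof.
rewrite -[X in _ --> X]mulr1 -[X in _ --> s * X]subr0 -[X in _ --> s * (1 - X)](mul0r 2^-1).
apply: cvgM; first exact: cvg_cst.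
apply: cvgB; first exact: cvg_cst.
by apply: cvgM; [exact: cvg_harmonic|exact: cvg_cst].
Qed.

(** The split on [w x = 0] sets aside the endpoint where the limit denominator vanishes; all the
    kernels are 0 there. *)
Let kernel_cvg (e : R) x : `|e| = 1 -> D x ->
  (fun k => semicircle_kernel e (approach k) x) @ \oo --> semicircle_kernel e s x.
Proof.
move=> e1 xD; have [w0|w0] := eqVneq (w x) 0.
  rewrite /semicircle_kernel w0 mul0r; under eq_fun do rewrite mul0r.
  exact: cvg_cst.
apply: cvgM; first exact: cvg_cst.
apply: cvgV.
  apply: contra_neq w0 => dz.
  by rewrite -(semicircle_kernelE e1 s0 xD) dz mul0r.
apply: cvgB; last exact: cvg_cst.
apply: cvgD; first exact: approach_cvg.
apply: cvgM; first exact: cvg_cst.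
by apply: cvgV; [rewrite gt_eqF|exact: approach_cvg].
Qed.

(* For [v = s] the denominator vanishes at an endpoint of the interval; this
   case is reached from [v < s] by monotone convergence. *)
Lemma integral_semicircle_kernel (e v : R) : `|e| = 1 -> 0 < v <= s ->
  mu.-integrable D (EFin \o semicircle_kernel e v) /\
  \int[mu]_(x in D) semicircle_kernel e v x = 2 * pi * v.
Proof.
move=> e1 /andP[v0]; rewrite le_eqVlt => /predU1P[->|vs]; last first.
  have v0s : 0 < v < s by rewrite v0.
  by split; [exact: integrable_semicircle_kernel_lt|exact: integral_semicircle_kernel_lt].
have mk k : measurable_fun D (semicircle_kernel e (approach k)).
  by have /measurable_int/measurable_EFinP :=
    integrable_semicircle_kernel_lt e1 (approach_itv k).
have ms : measurable_fun D (semicircle_kernel e s).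
  by apply: measurable_fun_cvg mk _ => x; exact: kernel_cvg.
have Is : (\int[mu]_(x in D) (semicircle_kernel e s x)%:E = (2 * pi * s)%:E)%E.
  transitivity (\int[mu]_(x in D)
      limn (fun k => (semicircle_kernel e (approach k) x)%:E))%E.
    apply: eq_integral => x; rewrite inE => xD; apply/esym/cvg_lim => //.
    by apply: cvg_EFin; [exact: nearW|exact: kernel_cvg].
  rewrite monotone_convergence//=.
  - apply/cvg_lim => //.
    have -> : (fun k => \int[mu]_(x in D) (semicircle_kernel e (approach k) x)%:E)%E =
        (fun k => (2 * pi * approach k)%:E).
      apply/funext => k; rewrite -(integral_semicircle_kernel_lt e1 (approach_itv k)).
      rewrite /Rintegral fineK//.
      by have := integrable_fin_num _ (integrable_semicircle_kernel_lt e1 (approach_itv k)); apply.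
    by apply: cvg_EFin; [exact: nearW|apply: cvgM; [exact: cvg_cst|exact: approach_cvg]].
  - by move=> k; apply/measurable_EFinP; exact: mk.
  - move=> k x xD; rewrite lee_fin semicircle_kernel_ge0//.
    by have /andP[] := approach_itv k.
  - move=> x xD m n mn; rewrite lee_fin semicircle_kernel_nd//.
    + by have /andP[] := approach_itv m.
    + exact: approach_nd.
    + by have /andP[] := approach_itv n.
split; last by rewrite /Rintegral Is.
apply/integrableP; split; first exact/measurable_EFinP.
under eq_integral => x do [rewrite inE => xD;
  rewrite gee0_abs ?lee_fin ?semicircle_kernel_ge0//].
by rewrite /= Is ltry.
Qed.

(** The geometric sequence of ratio [e v] solves the recursion of [chebyshev_moments_rec], and the
    first two moments single it out. *)
Lemma integral_chebyshev_kernel (e v : R) n : `|e| = 1 -> 0 < v <= s ->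
  \int[mu]_(x in D) ((V n).[x] * semicircle_kernel e v x) =
  2 * pi * v * (e * v) ^+ n.
Proof.
move=> e1 vs; have v0 : 0 < v by have /andP[] := vs.
have ee : e * e = 1 by rewrite -expr2 -(real_normK (num_real e)) e1 expr1n.
have [ig I0] := integral_semicircle_kernel e1 vs.
have [h0 hS] := chebyshev_moments_rec ig (fun x => semicircle_kernelE e1 v0 (x := x)).
pose h n := \int[mu]_(x in D) ((V n).[x] * semicircle_kernel e v x).
rewrite -/(h 0%N) -/(h 1%N) in h0; rewrite -/(h n).
have {}hS m : (v + s ^+ 2 / v) * h m.+1 = e * (h m.+2 + s ^+ 2 * h m) by exact: hS.
have {}I0 : h 0%N = 2 * pi * v.
  by rewrite -I0; apply: eq_Rintegral => x _; rewrite chebyshev0 mul1r.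
have h1 : h 1%N = 2 * pi * v * (e * v).
  have eh1 : e * h 1%N = (v + s ^+ 2 / v) * h 0%N - 2 * pi * s ^+ 2.
    by rewrite -h0 opprB addrC subrK.
  have -> : h 1%N = e * (e * h 1%N) by rewrite mulrA ee mul1r.
  rewrite eh1 I0; field.
  by rewrite gt_eqF.
elim/ltn_ind: n => -[|[|n]] IH; rewrite ?I0 ?h1 ?mulr1//.
have -> : h n.+2 = e * (v + s ^+ 2 / v) * h n.+1 - s ^+ 2 * h n.
  by rewrite -mulrA hS mulrA ee mul1r addrK.
rewrite !IH// !exprS.
rewrite [X in X - _](_ : _ = e * e * ((v + s ^+ 2 / v) * v * (2 * pi * v * (e * v) ^+ n))).
  by rewrite ee mul1r mulrDl divfK ?gt_eqF//; ring: ee.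
by ring.
Qed.

End SemicircleTransform.

(** * The law of the free Jacobi process *)

Section FreeJacobiPolynomials.
Context (R : realType) (a b : R).

(** With [a = lambda * theta] and [b = theta], the endpoints [x_-] and [x_+] are [c - 2 s] and
    [c + 2 s]. *)
Definition jacobi_center : R := a + b - 2 * a * b.
Definition jacobi_radius : R := Num.sqrt (b * (1 - a)) * Num.sqrt (a * (1 - b)).
Notation c := jacobi_center.
Notation s := jacobi_radius.
Notation V := (chebyshev c s).

(* For free projections [p], [q] of traces [a], [b], the alternating word
   [p (q - b) (p - a) ... (q - b) p] with [n] factors [q - b] is the value at
   [p q p] of this polynomial. *)
Definition free_jacobi n : {poly R} :=
  match n with
  | 0 => 1
  | 1 => 'X - b%:P
  | n'.+2 => V n + a * (1 - 2 * b) *: V n'.+1 - a ^+ 2 * b * (1 - b) *: V n'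
  end.
Notation K := free_jacobi.

Lemma free_jacobi0 x : (K 0).[x] = 1.
Proof. by rewrite /= hornerE. Qed.

Lemma free_jacobi1 x : (K 1).[x] = x - b.
Proof. by rewrite /= !hornerE. Qed.

Lemma free_jacobiSS n x : (K n.+2).[x] = (V n.+2).[x] +
  a * (1 - 2 * b) * (V n.+1).[x] - a ^+ 2 * b * (1 - b) * (V n).[x].
Proof. by rewrite {1}/free_jacobi hornerD hornerN hornerD !hornerZ. Qed.

Hypotheses (a01 : 0 < a <= 1) (b01 : 0 < b < 1).

Let a0 : 0 < a. Proof. by case/andP: a01. Qed.
Let a1 : 0 <= 1 - a. Proof. by case/andP: a01 => ? ?; rewrite subr_ge0. Qed.
Let b0 : 0 < b. Proof. by case/andP: b01. Qed.
Let b1 : 0 < 1 - b. Proof. by case/andP: b01 => ? ?; rewrite subr_gt0. Qed.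

Lemma jacobi_radius_sqr : s ^+ 2 = a * b * (1 - a) * (1 - b).
Proof.
rewrite exprMn (sqr_sqrtr (mulr_ge0 (ltW b0) a1)).
by rewrite (sqr_sqrtr (mulr_ge0 (ltW a0) (ltW b1))); ring.
Qed.

Lemma free_jacobi2 x :
  (K 2).[x] = (x - c) * (K 1).[x] - a * b * (1 - b) * (K 0).[x].
Proof.
rewrite free_jacobiSS free_jacobi1 free_jacobi0 chebyshevSS chebyshev1 chebyshev0.
by rewrite jacobi_radius_sqr /jacobi_center; ring.
Qed.

Lemma free_jacobiS3 n x : (K n.+3).[x] =
  (x - c) * (K n.+2).[x] - a * b * (1 - a) * (1 - b) * (K n.+1).[x].
Proof.
(* For [n = 0] the recursion involves [K 1], which has its own defining clause. *)
rewrite -jacobi_radius_sqr; case: n => [|n].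
  rewrite !free_jacobiSS free_jacobi1 !chebyshevSS chebyshev1 chebyshev0.
  by rewrite /jacobi_center; ring.
by rewrite !free_jacobiSS (chebyshevSS _ _ n.+2) (chebyshevSS _ _ n.+1) (chebyshevSS _ _ n);
   ring.
Qed.

(** At 0 the characteristic roots of the recursion are [- b (1 - a)] and [- a (1 - b)]; the initial
    values select the first. *)
Lemma free_jacobi_at0 n : (K n.+1).[0] = - b * (- (b * (1 - a))) ^+ n.
Proof.
elim/ltn_ind: n => -[|[|n]] IH.
- by rewrite free_jacobi1; ring.
- by rewrite free_jacobi2 free_jacobi1 free_jacobi0 /jacobi_center; ring.
- by rewrite free_jacobiS3 IH// IH// !exprS /jacobi_center; ring.
Qed.

(** At 1 the roots are [(1 - a) (1 - b)] and [a b], and again only the first occurs. *)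
Lemma free_jacobi_at1 n : (K n.+1).[1] = (1 - b) * ((1 - a) * (1 - b)) ^+ n.
Proof.
elim/ltn_ind: n => -[|[|n]] IH.
- by rewrite free_jacobi1; ring.
- by rewrite free_jacobi2 free_jacobi1 free_jacobi0 /jacobi_center; ring.
- by rewrite free_jacobiS3 IH// IH// !exprS /jacobi_center; ring.
Qed.

Notation mu := (@lebesgue_measure R).
Notation D := (`[(c - 2 * s)%R, (c + 2 * s)%R]%classic : set R).

Definition jacobi_density (x : R) : R :=
  semicircle c s x / (2 * a * pi * x * (1 - x)).

Definition jacobi_atom0 : R := Num.max 0 (1 - b / a).
Definition jacobi_atom1 : R := Num.max 0 (1 - (1 - b) / a).

(** Integration against the measure of the statement, defined on polynomials before that measure is
    known to have mass 1. *)
Definition jacobi_moment (p : {poly R}) : R :=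
  jacobi_atom0 * p.[0] + jacobi_atom1 * p.[1] +
  \int[mu]_(x in D) (p.[x] * jacobi_density x).

Section Degenerate.
Hypothesis a_eq1 : a = 1.

Let s0 : s = 0.
Proof. by rewrite /jacobi_radius a_eq1 subrr mulr0 sqrtr0 mul0r. Qed.

Let D1 : D = [set c]%classic.
Proof. by rewrite s0 mulr0 subr0 addr0 set_itv1. Qed.

Lemma integrable_jacobi_density_degenerate :
  mu.-integrable D (EFin \o jacobi_density).
Proof.
rewrite D1; apply: null_set_integrable => //; first exact: measurable_fun_set1.
exact: lebesgue_measure_set1.
Qed.

(** The support is a single point, so only the atoms [1 - b] and [b] count. Their contributions
    cancel for [n = 1], and [K n] vanishes at 0 and 1 for [n >= 2]. *)
Lemma jacobi_moment_free_jacobi_degenerate n :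
  jacobi_moment (K n) = (n == 0%N)%:R.
Proof.
rewrite /jacobi_moment D1 Rintegral_set1 addr0.
have -> : jacobi_atom0 = 1 - b.
  by rewrite /jacobi_atom0 a_eq1 divr1 max_r// ltW.
have -> : jacobi_atom1 = b.
  by rewrite /jacobi_atom1 a_eq1 divr1 opprB addrC subrK max_r// ltW.
case: n => [|n]; first by rewrite !free_jacobi0 !mulr1 subrK.
rewrite free_jacobi_at0 free_jacobi_at1 a_eq1 subrr mulr0 mul0r oppr0.
by case: n => [|n] /=; rewrite ?expr0 ?exprS; ring.
Qed.

End Degenerate.

Section Nondegenerate.
Hypothesis a_lt1 : a < 1.

Let a1' : 0 < 1 - a. Proof. by rewrite subr_gt0. Qed.

Let s0 : 0 < s.
Proof. by rewrite mulr_gt0// sqrtr_gt0 mulr_gt0. Qed.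

(** [x] and [y] are the two solutions [v] of [v + s^2 / v = z]; the kernel integrals require the one
    that is at most [s]. *)
Let min_radius (x y z : R) : 0 < x -> 0 < y -> x * y = s ^+ 2 -> x + y = z ->
  0 < Num.min x y <= s /\ Num.min x y + s ^+ 2 / Num.min x y = z.
Proof.
move=> x0 y0 xy <-; rewrite -xy.
have H u v : 0 < u -> 0 < v -> u * v = s ^+ 2 -> u <= v ->
    0 < u <= s /\ u + u * v / u = u + v.
  move=> u0 v0 uv ulev; rewrite u0/= mulrAC divff ?gt_eqF// mul1r; split=> //.
  by rewrite -(@ler_pXn2r _ 2)// ?nnegrE ?(ltW u0) ?(ltW s0)// -uv expr2 ler_pM2l.
case: (leP x y) => [|/ltW] xley; first exact: H.
by rewrite (mulrC x y) [x + y]addrC; apply: H => //; rewrite mulrC.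
Qed.

(** The kernel parameters of the poles 0 ([e = -1]) and 1 ([e = 1]) of the density. *)
Let m0 : R := Num.min (a * (1 - b)) (b * (1 - a)).
Let m1 : R := Num.min ((1 - a) * (1 - b)) (a * b).

Let m0P : 0 < m0 <= s /\ m0 + s ^+ 2 / m0 = c.
Proof.
apply: min_radius; rewrite ?mulr_gt0// ?jacobi_radius_sqr ?/jacobi_center; ring.
Qed.

Let m1P : 0 < m1 <= s /\ m1 + s ^+ 2 / m1 = 1 - c.
Proof.
apply: min_radius; rewrite ?mulr_gt0// ?jacobi_radius_sqr ?/jacobi_center; ring.
Qed.

Notation g0 := (semicircle_kernel c s (-1) m0).
Notation g1 := (semicircle_kernel c s 1 m1).

Let normN1 : `|-1 : R| = 1. Proof. by rewrite normrN1. Qed.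
Let norm1 : `|1 : R| = 1. Proof. by rewrite normr1. Qed.

(* Partial fractions; at the possible singularities 0 and 1 of the density the
   semicircle factor vanishes, and all three quotients are 0. *)
Let density_split x : D x ->
  jacobi_density x = (2 * pi * a)^-1 * (g0 x + g1 x).
Proof.
move=> Dx; rewrite /jacobi_density.
have [/andP[m00 _] m0c] := m0P; have [/andP[m10 _] m1c] := m1P.
have pi0 : pi != 0 :> R by rewrite gt_eqF ?pi_gt0.
have := semicircle_kernelE s0 normN1 m00 Dx.
have := semicircle_kernelE s0 norm1 m10 Dx.
rewrite m0c m1c => E1 E0.
have [w0|w0] := eqVneq (semicircle c s x) 0.
  by rewrite /semicircle_kernel w0 !mul0r addr0 mulr0.
rewrite /semicircle_kernel m0c m1c.
have -> : c - -1 * (x - c) = x by ring.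
have -> : 1 - c - 1 * (x - c) = 1 - x by ring.
have x0 : x != 0.
  apply: contra_neq w0 => x0; rewrite -E0 x0 -[X in X * _](_ : 0 = _) ?mul0r//.
  by ring.
have x1 : 1 - x != 0.
  apply: contra_neq w0 => x1; rewrite -E1 -[X in X * _](_ : 0 = _) ?mul0r//.
  by rewrite -x1; ring.
move: (@pi R) pi0 => p p0; field.
by rewrite x0 x1 p0 gt_eqF.
Qed.

Let ig0 : mu.-integrable D (EFin \o g0).
Proof. by have [] := integral_semicircle_kernel c s0 normN1 m0P.1. Qed.

Let ig1 : mu.-integrable D (EFin \o g1).
Proof. by have [] := integral_semicircle_kernel c s0 norm1 m1P.1. Qed.

Lemma integrable_jacobi_density_nondegenerate :
  mu.-integrable D (EFin \o jacobi_density).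
Proof.
have ig : mu.-integrable D (fun x => (2 * pi * a)^-1%:E * (g0 x + g1 x)%:E)%E.
  by apply: integrableZl => //; exact: integrableD ig0 ig1.
by apply: eq_integrable ig => // x /[!inE] Dx; rewrite /= (density_split Dx).
Qed.

Let I (g : R -> R) (p : {poly R}) : R := \int[mu]_(x in D) (p.[x] * g x).

Let IZ g k p : mu.-integrable D (EFin \o g) -> I g (k *: p) = k * I g p.
Proof.
move=> ig; rewrite -(RintegralZl k _ (integrable_hornerM p ig))//.
by apply: eq_Rintegral => x _; rewrite hornerZ mulrA.
Qed.

Let ID g p q : mu.-integrable D (EFin \o g) -> I g (p + q) = I g p + I g q.
Proof.
move=> ig; rewrite -(RintegralD _ (integrable_hornerM p ig) (integrable_hornerM q ig))//.
by apply: eq_Rintegral => x _; rewrite hornerD mulrDl.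
Qed.

Let Idensity p : I jacobi_density p = (2 * pi * a)^-1 * (I g0 p + I g1 p).
Proof.
have i0 := integrable_hornerM p ig0; have i1 := integrable_hornerM p ig1.
transitivity (\int[mu]_(x in D) ((2 * pi * a)^-1 * (p.[x] * g0 x + p.[x] * g1 x))).
  apply: eq_Rintegral => x; rewrite inE => Dx; rewrite (density_split Dx).
  by rewrite [LHS]mulrCA (mulrDr p.[x]).
rewrite RintegralZl//; last exact: integrableD i0 i1.
by rewrite RintegralD.
Qed.

(** The integral of [K n] against [g] when the [V n] have geometric integrals of ratio [r]. *)
Let J g (r : R) n :=
  match n with
  | 0 => 1
  | 1 => r + a * (1 - 2 * b)
  | n'.+2 => r ^+ n' * (r ^+ 2 + a * (1 - 2 * b) * r - a ^+ 2 * b * (1 - b))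
  end * I g 1.

Let IK g r n : mu.-integrable D (EFin \o g) ->
  (forall n, I g (V n) = I g 1 * r ^+ n) -> I g (K n) = J g r n.
Proof.
move=> ig IV; case: n => [|[|n]]; first by rewrite /J mul1r.
  rewrite (_ : K 1 = V 1 + a * (1 - 2 * b) *: V 0).
    by rewrite ID// IZ// !IV /J; ring.
  rewrite /= alg_polyC -addrA -!polyCN -polyCD; congr (_ + _%:P).
  by rewrite /jacobi_center; ring.
rewrite (_ : K n.+2 = V n.+2 + a * (1 - 2 * b) *: V n.+1
  - a ^+ 2 * b * (1 - b) *: V n)// ID// -(scaleNr _ (V n)) ID// !IZ// !IV /J /= !exprS; ring.
Qed.

Lemma jacobi_moment_free_jacobi_nondegenerate n :
  jacobi_moment (K n) = (n == 0%N)%:R.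
Proof.
have pi0 : pi != 0 :> R by rewrite gt_eqF ?pi_gt0.
have an0 : a != 0 by rewrite gt_eqF.
rewrite /jacobi_moment -/(I jacobi_density (K n)) Idensity.
have IV0 m : I g0 (V m) = 2 * pi * m0 * (- m0) ^+ m.
  by rewrite -[X in X ^+ m]mulN1r -(integral_chebyshev_kernel c s0 _ normN1 m0P.1).
have IV1 m : I g1 (V m) = 2 * pi * m1 * m1 ^+ m.
  by rewrite -[X in X ^+ m]mul1r -(integral_chebyshev_kernel c s0 _ norm1 m1P.1).
have I0 : I g0 1 = 2 * pi * m0 by have := IV0 0%N; rewrite /= mulr1.
have I1 : I g1 1 = 2 * pi * m1 by have := IV1 0%N; rewrite /= mulr1.
rewrite (@IK g0 (- m0) n ig0) ?I0//; rewrite (@IK g1 m1 n ig1) ?I1//.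
(* One and the same inequality decides the minimum [m0] and the presence of the atom at 0; likewise
   for [m1] and the atom at 1. *)
have C0 : (m0 = a * (1 - b) /\ jacobi_atom0 = 0) \/
          (m0 = b * (1 - a) /\ jacobi_atom0 = 1 - b / a).
  have E : (a * (1 - b) <= b * (1 - a)) = (1 - b / a <= 0).
    by rewrite subr_le0 ler_pdivlMr// mul1r !mulrBr !mulr1 [b * a]mulrC lerD2r.
  rewrite /m0 /jacobi_atom0; case: (leP (a * (1 - b)) (b * (1 - a))); rewrite ?E => h.
    by left; rewrite max_l.
  by right; rewrite max_r// ltW// ltNge -E -ltNge.
have C1 : (m1 = (1 - a) * (1 - b) /\ jacobi_atom1 = 1 - (1 - b) / a) \/
          (m1 = a * b /\ jacobi_atom1 = 0).
  have E : ((1 - a) * (1 - b) <= a * b) = (0 <= 1 - (1 - b) / a).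
    rewrite subr_ge0 ler_pdivrMr// mul1r -subr_ge0 -[RHS]subr_ge0; congr (0 <= _).
    by ring.
  rewrite /m1 /jacobi_atom1; case: (leP ((1 - a) * (1 - b)) (a * b)); rewrite ?E => h.
    by left; rewrite max_r.
  by right; rewrite max_l// ltW// ltNge -E -ltNge.
rewrite /J I0 I1; move: (@pi R) pi0 => p p0.
(* For [n >= 2] the quadratic in [J] is [(r + a (1 - b)) (r - a b)]: it vanishes for the parameter
   without atom, and otherwise its term cancels that of the atom. *)
case: n => [|[|n]]; rewrite ?free_jacobi0 ?free_jacobi_at0 ?free_jacobi_at1 /=;
  case: C0 => -[-> ->]; case: C1 => -[-> ->]; rewrite ?exprS; field; rewrite ?an0 ?p0//.
Qed.

End Nondegenerate.

Lemma integrable_jacobi_density : mu.-integrable D (EFin \o jacobi_density).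
Proof.
have /andP[_] := a01; rewrite le_eqVlt => /predU1P[|].
- by move=> h; exact: integrable_jacobi_density_degenerate.
- by move=> h; exact: integrable_jacobi_density_nondegenerate.
Qed.

Lemma jacobi_moment_free_jacobi n : jacobi_moment (K n) = (n == 0%N)%:R.
Proof.
have /andP[_] := a01; rewrite le_eqVlt => /predU1P[|].
- by move=> h; exact: jacobi_moment_free_jacobi_degenerate.
- by move=> h; exact: jacobi_moment_free_jacobi_nondegenerate.
Qed.

End FreeJacobiPolynomials.

(** * A probability measure made of a density and atoms at 0 and 1 *)

Section AtomicMixture.
Context (R : realType) (p0 p1 lo hi : R) (f : R -> R).
Notation T := (measurableTypeR R).
Notation mu := (@lebesgue_measure R).
Notation D := (`[lo, hi]%classic : set T).
Hypotheses (p00 : 0 <= p0) (p10 : 0 <= p1) (lo0 : 0 <= lo) (hi1 : hi <= 1).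
Hypothesis f0 : forall x, D x -> 0 <= f x.
Hypothesis intf : mu.-integrable D (EFin \o f).
Hypothesis mass : p0 + p1 + \int[mu]_(x in D) f x = 1.

Let g : T -> R := f \_ D.

Let g0 x : 0 <= g x.
Proof. by rewrite /g patchE; case: ifPn => // /[!inE]; exact: f0. Qed.

Let intg : mu.-integrable setT (EFin \o g).
Proof. by rewrite /g -restrict_EFin; apply/integrable_restrict => //; rewrite setTI. Qed.

Let mg : measurable_fun setT (EFin \o g).
Proof. exact: measurable_int intg. Qed.

Let nu (B : set T) : \bar R := (\int[mu]_(x in B) (g x)%:E)%E.

Let nuE B : nu B = density_on lo hi f B.
Proof.
rewrite /nu /density_on integral_mkcondr.
by under [RHS]eq_integral do rewrite restrict_EFin.
Qed.

Let nu0 : nu set0 = 0%E. Proof. exact: integral_set0. Qed.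

Let nu_ge0 B : (0 <= nu B)%E.
Proof. by apply: integral_ge0 => x _; rewrite lee_fin. Qed.

Let nu_sigma_additive : semi_sigma_additive nu.
Proof. by apply: semi_sigma_additive_nng_induced => // x; rewrite lee_fin. Qed.

HB.instance Definition _ :=
  isMeasure.Build _ T R nu nu0 nu_ge0 nu_sigma_additive.

Let nu_fin : fin_num_fun nu.
Proof.
by move=> B mB; apply: integrable_fin_num => //; exact: integrableS intg.
Qed.

HB.instance Definition _ := Measure_isFinite.Build _ T R nu nu_fin.

Let nu_dom : nu `<< mu.
Proof.
apply/null_content_dominatesP => B mB B0.
by apply: null_set_integral => //; exact: measurable_funTS.
Qed.

(** [g] has the same integrals over measurable sets as the Radon-Nikodym derivative of [nu], hence
    equals it almost everywhere. *)
Let integral_nu (h : T -> \bar R) : (forall x, 0 <= h x)%E ->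
  measurable_fun setT h ->
  (\int[nu]_x h x = \int[mu]_x (h x * (g x)%:E))%E.
Proof.
move=> h0 mh.
rewrite -(Radon_Nikodym_SigmaFinite.change_of_variables nu_dom h0 measurableT mh).
have iRN := Radon_Nikodym_SigmaFinite.f_integrable nu_dom.
apply: ae_eq_integral => //.
- by apply: emeasurable_funM => //; exact: measurable_int iRN.
- exact: emeasurable_funM.
- apply: ae_eqe_mul2l; apply: integral_ae_eq => //= B _ mB.
  by rewrite -Radon_Nikodym_SigmaFinite.f_integral.
Qed.

Let rho : set T -> \bar R :=
  measure_add
    (measure_add (mscale (NngNum p00) (dirac (0%R : T)))
                 (mscale (NngNum p10) (dirac (1%R : T)))) nu.

HB.instance Definition _ := Measure.on rho.

Let rhoE B : rho B =
  (p0%:E * dirac (0%R : T) B + p1%:E * dirac (1%R : T) B + density_on lo hi f B)%E.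
Proof. by rewrite -nuE /rho measure_addE [X in (X + _)%E]measure_addE. Qed.

Let rho_supported (B : set T) : `[0, 1]%classic `<=` B -> rho B = 1%E.
Proof.
move=> sB; rewrite rhoE !diracE !mem_set; last 2 first.
- by apply: sB; rewrite /= in_itv/= ler01 lexx.
- by apply: sB; rewrite /= in_itv/= ler01 lexx.
rewrite !mule1 /density_on (_ : B `&` D = D); last first.
  apply/setIidPr; apply: subset_trans sB => x /=.
  rewrite !in_itv/= => /andP[xlo xhi].
  by rewrite (le_trans lo0 xlo) (le_trans xhi hi1).
rewrite -mass !EFinD; congr (_ + _)%E; rewrite /Rintegral fineK//.
by apply: integrable_fin_num.
Qed.

Let rho_setT : rho setT = 1%E. Proof. exact: rho_supported. Qed.

HB.instance Definition _ := Measure_isProbability.Build _ T R rho rho_setT.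

Let integral_rho (h : T -> R) : (forall x, 0 <= h x) -> measurable_fun setT h ->
  (\int[rho]_x (h x)%:E =
   (p0 * h 0)%:E + (p1 * h 1)%:E + \int[mu]_(x in D) (h x * f x)%:E)%E.
Proof.
move=> h0 mh; have mh' : measurable_fun setT (EFin \o h) by exact/measurable_EFinP.
have h0' x : (0 <= (EFin \o h) x)%E by rewrite lee_fin.
rewrite /rho ge0_integral_measure_add//; last by move=> x _; exact: h0'.
rewrite ge0_integral_measure_add//; last by move=> x _; exact: h0'.
rewrite !ge0_integral_mscale//; try by move=> x _; exact: h0'.
rewrite !integral_dirac// !diracT !mul1e integral_nu// [in RHS]integral_mkcond.
congr (_ + _ + _)%E; apply: eq_integral => x _.
by rewrite /g -EFinM !patchE; case: ifP => _ //; rewrite mulr0.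
Qed.

Lemma atomic_mixture : exists P : probability T R,
  [/\ forall B, measurable B -> P B =
        (p0%:E * dirac (0%R : T) B + p1%:E * dirac (1%R : T) B +
         density_on lo hi f B)%E,
      P `[- 1, 1]%classic = 1%E &
      forall n, (\int[P]_x (x ^+ n) = p0 * 0 ^+ n + p1 * 1 ^+ n +
        \int[mu]_(x in D) (x ^+ n * f x))%R].
Proof.
exists rho; split=> [B _||n]; first exact: rhoE.
  apply: rho_supported => x /=; rewrite !in_itv/= => /andP[x0 ->].
  by rewrite andbT (le_trans _ x0)// lerN10.
have mX : measurable_fun setT (fun x : T => x ^+ n) by exact: exprn_measurable.
(* [integral_rho] takes nonnegative functions; [h] agrees with the power on [[0, 1]], whose
   complement is [rho]-null. *)
pose h (x : T) : R := `|x ^+ n|.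
have mh : measurable_fun setT h by exact: measurableT_comp.
have -> : (\int[rho]_x (x ^+ n) = \int[rho]_x (h x))%R.
  congr fine; apply: ae_eq_integral => //; [exact/measurable_EFinP..|].
  exists (~` `[0, 1]%classic); split.
  - by apply: measurableC; exact: measurable_itv.
  - have := probability_setC rho (measurable_itv `[0, 1]).
    by rewrite /= (rho_supported (B := `[0, 1]))// => ->; rewrite subee.
  - move=> x /= xn; apply: contra_not xn; rewrite in_itv/= => /andP[x0 _] _.
    by rewrite /h ger0_norm// exprn_ge0.
rewrite /Rintegral integral_rho//; last by move=> x; rewrite /h.
have -> : (\int[mu]_(x in D) (h x * f x)%:E = \int[mu]_(x in D) (x ^+ n * f x)%:E)%E.
  apply: eq_integral => x; rewrite inE /= in_itv/= => /andP[xlo _].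
  by rewrite /h ger0_norm// exprn_ge0// (le_trans lo0).
have ixf : mu.-integrable D (fun x => (x ^+ n * f x)%:E).
  apply: le_integrable intf => //.
    apply/measurable_EFinP/measurable_funM; first exact: measurable_funTS.
    by apply/measurable_EFinP; exact: measurable_int intf.
  move=> x /=; rewrite in_itv/= => /andP[xlo xhi].
  have x0 := le_trans lo0 xlo.
  rewrite lee_fin normrM ler_piMl// ger0_norm ?exprn_ge0//.
  by rewrite exprn_ile1// (le_trans xhi).
by rewrite fineD//= ?(integrable_fin_num _ ixf)// /h !ger0_norm// exprn_ge0.
Qed.

End AtomicMixture.

(** * The measure of the statement and the recursion of its moments *)

Section JacobiLaw.
Context (R : realType).

Section Moments.
Context (a b : R).
Hypotheses (a01 : 0 < a <= 1) (b01 : 0 < b < 1).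
Notation c := (jacobi_center a b).
Notation s := (jacobi_radius a b).
Notation K := (free_jacobi a b).

Lemma eq_jacobi_moment (p q : {poly R}) : horner p =1 horner q ->
  jacobi_moment a b p = jacobi_moment a b q.
Proof.
move=> pq; rewrite /jacobi_moment !pq; congr (_ + _).
by apply: eq_Rintegral => x _; rewrite pq.
Qed.

Lemma jacobi_momentD p q :
  jacobi_moment a b (p + q) = jacobi_moment a b p + jacobi_moment a b q.
Proof.
have ig := integrable_jacobi_density a01 b01.
rewrite /jacobi_moment !hornerD.
under eq_Rintegral do rewrite hornerD mulrDl.
by rewrite RintegralD//; [ring|exact: integrable_hornerM..].
Qed.

Lemma jacobi_momentZ k p : jacobi_moment a b (k *: p) = k * jacobi_moment a b p.
Proof.
have ig := integrable_jacobi_density a01 b01.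
rewrite /jacobi_moment !hornerZ.
under eq_Rintegral do rewrite hornerZ -mulrA.
by rewrite RintegralZl//; [ring|exact: integrable_hornerM].
Qed.

(** The three-term recursion of [K], multiplied by ['X^i], expresses column [i.+1] through column
    [i]. *)
Lemma jacobi_moment_rec (m := fun n i => jacobi_moment a b (K n * 'X^i)) :
  [/\ forall n, m n 0%N = (n == 0%N)%:R,
      forall i, m 0%N i.+1 = m 1%N i + b * m 0%N i,
      forall i, m 1%N i.+1 = m 2 i + c * m 1%N i + a * b * (1 - b) * m 0%N i &
      forall n i, m n.+2 i.+1 =
        m n.+3 i + c * m n.+2 i + a * b * (1 - a) * (1 - b) * m n.+1 i].
Proof.
split=> [n|i|i|n i].
- by rewrite /m expr0 mulr1 jacobi_moment_free_jacobi.
- rewrite -jacobi_momentZ -jacobi_momentD; apply: eq_jacobi_moment => x.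
  rewrite hornerD hornerZ !hornerM free_jacobi1 free_jacobi0 !hornerXn exprS.
  by ring.
- rewrite -!jacobi_momentZ -!jacobi_momentD; apply: eq_jacobi_moment => x.
  rewrite !hornerD !hornerZ !hornerM free_jacobi2// free_jacobi1 free_jacobi0.
  by rewrite !hornerXn exprS; ring.
- rewrite -!jacobi_momentZ -!jacobi_momentD; apply: eq_jacobi_moment => x.
  by rewrite !hornerD !hornerZ !hornerM free_jacobiS3// !hornerXn exprS; ring.
Qed.

(** The distances of the support to 0 and to 1 are squares: [s] factors both as
    [sqrt (b (1 - a)) sqrt (a (1 - b))] and as [sqrt ((1 - a) (1 - b)) sqrt (a b)]. *)
Lemma jacobi_support : 0 <= c - 2 * s /\ c + 2 * s <= 1.
Proof.
have [/andP[a0 a1] /andP[b0 b1]] := (a01, b01).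
have [p1 p2] : 0 <= b * (1 - a) /\ 0 <= a * (1 - b).
  by split; apply: mulr_ge0; lra.
have [p3 p4] : 0 <= (1 - a) * (1 - b) /\ 0 <= a * b.
  by split; apply: mulr_ge0; lra.
split.
  have -> : c - 2 * s = (Num.sqrt (b * (1 - a)) - Num.sqrt (a * (1 - b))) ^+ 2.
    by rewrite sqrrB !sqr_sqrtr// /jacobi_radius /jacobi_center; ring.
  exact: sqr_ge0.
rewrite -subr_ge0.
have -> : 1 - (c + 2 * s) = (Num.sqrt ((1 - a) * (1 - b)) - Num.sqrt (a * b)) ^+ 2.
  rewrite sqrrB !sqr_sqrtr// /jacobi_radius /jacobi_center -!sqrtrM//.
  by rewrite (_ : b * _ * _ = (1 - a) * (1 - b) * (a * b)); ring.
exact: sqr_ge0.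
Qed.

End Moments.

Lemma jacobi_law (lambda theta : R) :
  0 < lambda -> 0 < theta < 1 -> lambda * theta <= 1 ->
  exists P : probability (measurableTypeR R) R,
  [/\ forall B, measurable B -> P B = jacobi_measure lambda theta B,
      P `[- 1, 1]%classic = 1%E &
      forall n, \int[P]_x (x ^+ n) = jacobi_moment (lambda * theta) theta 'X^n].
Proof.
move=> l0 t01 lt1; pose a := lambda * theta; pose b := theta.
have /andP[t0 t1] := t01.
have a0 : 0 < a by rewrite mulr_gt0.
have a01 : 0 < a <= 1 by rewrite a0.
have [lo0 hi1] := jacobi_support a01 t01.
have p00 : 0 <= jacobi_atom0 a b by rewrite le_max lexx.
have p10 : 0 <= jacobi_atom1 a b by rewrite le_max lexx.
have f0 x : `[jacobi_center a b - 2 * jacobi_radius a b,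
    jacobi_center a b + 2 * jacobi_radius a b]%classic x ->
    0 <= jacobi_density a b x.
  rewrite /= in_itv/= => /andP[xlo xhi]; apply: divr_ge0; first exact: sqrtr_ge0.
  have x0 : 0 <= x by exact: le_trans xlo.
  have x1 : 0 <= 1 - x by rewrite subr_ge0; exact: le_trans xhi _.
  by rewrite !mulr_ge0 ?pi_ge0// ltW.
have intf := integrable_jacobi_density a01 t01.
have E0 x : (free_jacobi a b 0).[x] = 1 by rewrite free_jacobi0.
have mass : jacobi_atom0 a b + jacobi_atom1 a b +
    \int[lebesgue_measure]_(x in `[jacobi_center a b - 2 * jacobi_radius a b,
      jacobi_center a b + 2 * jacobi_radius a b]) jacobi_density a b x = 1.
  rewrite -[RHS](jacobi_moment_free_jacobi a01 t01 0) /jacobi_moment !E0 !mulr1.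
  by congr (_ + _); apply: eq_Rintegral => x _; rewrite E0 mul1r.
have [P [PE P1 PX]] := atomic_mixture p00 p10 lo0 hi1 f0 intf mass.
exists P; split=> [B mB||n] //; last first.
  by rewrite PX /jacobi_moment !hornerXn; under [in RHS]eq_Rintegral do rewrite hornerXn.
rewrite PE// /jacobi_measure.
have [q1 q2] : 0 <= b * (1 - a) /\ 0 <= a * (1 - b).
  by split; apply: mulr_ge0; rewrite ?subr_ge0 // ltW.
have xmE : jacobi_xm lambda theta = jacobi_center a b - 2 * jacobi_radius a b.
  rewrite /jacobi_xm -/a -/b sqrrB !sqr_sqrtr// /jacobi_radius /jacobi_center.
  by ring.
have xpE : jacobi_xp lambda theta = jacobi_center a b + 2 * jacobi_radius a b.
  rewrite /jacobi_xp -/a -/b sqrrD !sqr_sqrtr// /jacobi_radius /jacobi_center.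
  by ring.
rewrite xmE xpE.
have -> : 1 / lambda = b / a by rewrite /a /b; field; rewrite !gt_eqF.
congr (_ + _)%E; congr (integral _ _ _); apply/funext => x; congr (_%:E).
rewrite /jacobi_density /jacobi_pdf xmE xpE.
rewrite /semicircle /a mulrA; congr (Num.sqrt _ / _); ring.
Qed.

End JacobiLaw.

(** By induction on [i]: column 0 determines all the others. *)
Lemma jacobi_rec_unique (A : pzRingType) (b c k d : A) (t u : nat -> nat -> A) :
  let rec (m : nat -> nat -> A) :=
    [/\ forall i, m 0%N i.+1 = m 1%N i + b * m 0%N i,
        forall i, m 1%N i.+1 = m 2 i + c * m 1%N i + k * m 0%N i &
        forall n i, m n.+2 i.+1 = m n.+3 i + c * m n.+2 i + d * m n.+1 i] in
  rec t -> rec u -> (forall n, t n 0%N = u n 0%N) -> forall i n, t n i = u n i.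
Proof.
move=> /= [t0 t1 t2] [u0 u1 u2] tu0; elim=> [//|i IH] [|[|n]].
- by rewrite t0 u0 !IH.
- by rewrite t1 u1 !IH.
- by rewrite t2 u2 !IH.
Qed.

(** * Freeness and corner moments *)

Section Adjoints.
Context (R : realType) (H : completeNormedModType R[i]).
Variable dot : {dot H for conjC}.
Hypothesis hdot : hilbert_norm dot.
Notation C := R[i].
Notation bop := (bop H).
Implicit Types (a b : bop) (S : set bop).

Lemma dot_inj (y z : H) : (forall x, dot x y = dot x z) -> y = z.
Proof.
move=> yz; apply/eqP; rewrite -subr_eq0 -normr_eq0 -sqrf_eq0 hdot.
by rewrite linearBr /= yz subrr.
Qed.

Lemma adjoint_unique a b b' : is_adjoint dot a b -> is_adjoint dot a b' -> b = b'.
Proof.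
by move=> ab ab'; apply: bopP => y; apply: dot_inj => x; rewrite -ab -ab'.
Qed.

Lemma starE a b : is_adjoint dot a b -> star dot a = b.
Proof.
move=> ab; rewrite /star; case: xgetP => [b' _ /= ab'|/(_ b)//].
exact: adjoint_unique ab' ab.
Qed.

Lemma is_adjointM a a' b b' : is_adjoint dot a a' -> is_adjoint dot b b' ->
  is_adjoint dot (a * b) (b' * a').
Proof. by move=> aa' bb' x y; rewrite [LHS]aa' bb'. Qed.

Lemma commutant_one S : commutant S 1.
Proof. by move=> a _; rewrite mulr1 mul1r. Qed.

Lemma commutant_add S a b : commutant S a -> commutant S b -> commutant S (a + b).
Proof. by move=> Sa Sb x Sx; rewrite mulrDr mulrDl Sa// Sb. Qed.

Lemma commutant_scale S (k : C) a : commutant S a -> commutant S (k *: a).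
Proof. by move=> Sa x Sx; rewrite -bop_scaleAr -bop_scaleAl Sa. Qed.

Lemma commutant_mul S a b : commutant S a -> commutant S b -> commutant S (a * b).
Proof. by move=> Sa Sb x Sx; rewrite mulrA Sa// -mulrA Sb// mulrA. Qed.

(** The double commutant equation presents [S] as a commutant, and commutants are unital
    algebras. *)
Lemma von_neumann_star_subalgebra S : von_neumann_algebra dot S -> star_subalgebra dot S.
Proof.
move=> [starS SS]; split=> // [|a b|k a|a b]; rewrite -SS.
- exact: commutant_one.
- exact: commutant_add.
- exact: commutant_scale.
- exact: commutant_mul.
Qed.

Lemma star_subalgebra_star S a : star_subalgebra dot S -> S a ->
  S (star dot a) /\ is_adjoint dot a (star dot a).
Proof. by move=> sS /(subalg_star sS)[b Sb ab]; rewrite (starE ab). Qed.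

Lemma generated_mem S a : S a -> generated_algebra dot S a.
Proof. by move=> Sa B _; apply. Qed.

Lemma generated_one S : generated_algebra dot S 1.
Proof. by move=> B sB _; exact: subalg_one sB. Qed.

Lemma generated_add S a b : generated_algebra dot S a -> generated_algebra dot S b ->
  generated_algebra dot S (a + b).
Proof. by move=> Sa Sb B sB SB; apply: (subalg_add sB); [exact: Sa|exact: Sb]. Qed.

Lemma generated_scale S (k : C) a : generated_algebra dot S a ->
  generated_algebra dot S (k *: a).
Proof. by move=> Sa B sB SB; apply: (subalg_scale sB); exact: Sa. Qed.

Lemma generated_mul S a b : generated_algebra dot S a -> generated_algebra dot S b ->
  generated_algebra dot S (a * b).
Proof. by move=> Sa Sb B sB SB; apply: (subalg_mul sB); [exact: Sa|exact: Sb]. Qed.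

Lemma generated_star S a : generated_algebra dot S a ->
  generated_algebra dot S (star dot a).
Proof. by move=> Sa B sB SB; have [] := star_subalgebra_star sB (Sa B sB SB). Qed.

End Adjoints.

(** * Alternating words in two projections *)

Section TwoProjections.
Context (R : realType) (H : completeNormedModType R[i]).
Notation C := R[i].
Notation bop := (bop H).
Variables (a b : C) (p q : bop).
Hypotheses (pp : p * p = p) (qq : q * q = q).
Notation p0 := (p - a *: (1 : bop)).
Notation q0 := (q - b *: (1 : bop)).

(** [n] counts the factors [q0]; the empty word is [p], the unit of the corner. *)
Definition corner_word n : bop :=
  if n is m.+1 then p * (q0 * p0) ^+ m * q0 * p else p.

Lemma bop_mul_scale1 (k : C) (x : bop) : x * (k *: (1 : bop)) = k *: x.
Proof. by rewrite -bop_scaleAr mulr1. Qed.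

Lemma bop_scale1_mul (k : C) (x : bop) : (k *: (1 : bop)) * x = k *: x.
Proof. by rewrite -bop_scaleAl mul1r. Qed.

Let p0p : p0 * p = (1 - a) *: p.
Proof. by rewrite mulrBl pp bop_scale1_mul scalerBl scale1r. Qed.

Let q0q0 : q0 * q0 = (1 - 2 * b) *: q0 + (b * (1 - b)) *: (1 : bop).
Proof.
rewrite mulrBl mulrBr qq bop_scale1_mul bop_mul_scale1 !scalerBr !scalerA.
have -> : (b * (1 - b)) *: (1 : bop) =
    ((1 - 2 * b) * b) *: (1 : bop) + (b * b) *: (1 : bop).
  by rewrite -scalerDl; congr (_ *: _); ring.
rewrite [RHS]addrA subrK opprB addrA addrAC; congr (_ + _).
by rewrite -addrA -opprD -scalerDl scalerBl scale1r -mulr2n mulr_natl.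
Qed.

(** The inner [p] and [q] split as [p0 + a] and [q0 + b], and [q0q0] makes the square of [q0] affine
    in [q0]. *)
Let q0pqp : q0 * p * q * p = q0 * p0 * q0 * p +
  (a + b - 2 * a * b) *: (q0 * p) + (a * b * (1 - b)) *: p.
Proof.
have -> : q0 * p * q * p = q0 * p * q0 * p + b *: (q0 * p).
  rewrite [in RHS]mulrBr [in RHS]mulrBl bop_mul_scale1 -bop_scaleAl -[q0 * p * p]mulrA pp.
  by rewrite subrK.
have -> : q0 * p * q0 * p = q0 * p0 * q0 * p + a *: (q0 * q0 * p).
  rewrite [in RHS](mulrBr q0) bop_mul_scale1 [in RHS]mulrBl [in RHS]mulrBl.
  by rewrite -!bop_scaleAl subrK.
have -> : q0 * q0 * p = (1 - 2 * b) *: (q0 * p) + (b * (1 - b)) *: p.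
  by rewrite q0q0 [LHS]mulrDl -!bop_scaleAl mul1r.
rewrite [in LHS]scalerDr !scalerA -[LHS]addrA -[RHS]addrA; congr (_ + _).
have e : a * (1 - 2 * b) + b = a + b - 2 * a * b by ring.
by rewrite [LHS]addrAC -scalerDl e mulrA.
Qed.

Lemma corner_word0_step : p * (p * q * p) = corner_word 1 + b *: corner_word 0.
Proof.
rewrite /= expr0 mulr1 mulrBr mulrBl bop_mul_scale1 -bop_scaleAl pp subrK.
by rewrite !mulrA pp.
Qed.

(** The last word is [p] for [n = 0]; for [n > 0] the relation [p0p] turns it into [(1 - a)] times
    [corner_word n]. Hence the two forms of the recursion below. *)
Let corner_step n : corner_word n.+1 * (p * q * p) = corner_word n.+2 +
  (a + b - 2 * a * b) *: corner_word n.+1 +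
  (a * b * (1 - b)) *: (p * (q0 * p0) ^+ n * p).
Proof.
rewrite /corner_word.
have -> : p * (q0 * p0) ^+ n * q0 * p * (p * q * p) =
    p * (q0 * p0) ^+ n * (q0 * p * q * p).
  by rewrite !mulrA -(mulrA _ p p) pp.
move: (p - _) (q - _) q0pqp => u v ->.
by rewrite !(mulrDr (p * (v * u) ^+ n)) -!bop_scaleAr (exprSr _ n) !mulrA.
Qed.

Lemma corner_word1_step : corner_word 1 * (p * q * p) = corner_word 2 +
  (a + b - 2 * a * b) *: corner_word 1 + (a * b * (1 - b)) *: corner_word 0.
Proof. by rewrite corner_step expr0 mulr1 pp. Qed.

Lemma corner_wordSS_step n : corner_word n.+2 * (p * q * p) = corner_word n.+3 +
  (a + b - 2 * a * b) *: corner_word n.+2 +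
  (a * b * (1 - a) * (1 - b)) *: corner_word n.+1.
Proof.
rewrite corner_step; congr (_ + _).
rewrite exprSr !mulrA -[_ * p0 * p]mulrA p0p -bop_scaleAr scalerA.
congr (_ *: _); ring.
Qed.

Section Trace.
Variable dot : {dot H for conjC}.
Variables (A : set bop) (Phi : bop -> C).
Hypothesis (sA : star_subalgebra dot A).
Hypothesis tr : faithful_normal_tracial_state dot A Phi.
Hypotheses (Ap : A p) (Aq : A q).
Hypothesis free_odd : forall n, Phi ((q0 * p0) ^+ n * q0) = 0.
Hypothesis free_even : forall n, Phi ((q0 * p0) ^+ n.+1) = 0.

Let AM x y : A x -> A y -> A (x * y).
Proof. by move=> *; apply: (subalg_mul sA). Qed.
Let AD x y : A x -> A y -> A (x + y).
Proof. by move=> *; apply: (subalg_add sA). Qed.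
Let AZ k x : A x -> A (k *: x).
Proof. by move=> *; apply: (subalg_scale sA). Qed.
Let A1 : A 1. Proof. exact: subalg_one sA. Qed.
Let AB1 k x : A x -> A (x - k *: (1 : bop)).
Proof. by move=> Ax; rewrite -scaleNr; apply: AD => //; exact: AZ. Qed.
Let AX x n : A x -> A (x ^+ n).
Proof. by move=> Ax; elim: n => [//|n IH]; rewrite exprS; exact: AM. Qed.

Let Aword n : A (corner_word n).
Proof.
have ? := AB1 a Ap; have ? := AB1 b Aq.
by case: n => [//|n]; do ![apply: AM => //]; apply: AX; exact: AM.
Qed.

(** Traciality moves the first [p] to the end, where it is absorbed; writing the remaining [p] as
    [p0 + a] leaves the two kinds of centered alternating words. *)
Lemma state_corner_word n : Phi (corner_word n.+1) = 0.
Proof.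
have Ap0 := AB1 a Ap; have Aq0 := AB1 b Aq.
have Aqp : A ((q0 * p0) ^+ n) by apply: AX; exact: AM.
rewrite /corner_word -(mulrA p) -(mulrA p) (state_tracial tr) //; last first.
  by do ![apply: AM => //].
rewrite -(mulrA _ p p) pp (_ : _ * p = (q0 * p0) ^+ n.+1 + a *: ((q0 * p0) ^+ n * q0)).
  rewrite (state_add tr) ?(state_scale tr) ?free_even ?free_odd ?mulr0 ?addr0//.
  - exact: AM.
  - by apply: AX; exact: AM.
  - by apply: AZ; exact: AM.
have E (y : bop) : y * p = y * p0 + a *: y.
  by rewrite mulrBr bop_mul_scale1 subrK.
by rewrite [LHS]E exprSr [in RHS]mulrA.
Qed.

Lemma corner_moments_rec (m := fun n i => Phi (corner_word n * (p * q * p) ^+ i)) :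
  [/\ forall i, m 0%N i.+1 = m 1%N i + b * m 0%N i,
      forall i, m 1%N i.+1 =
        m 2 i + (a + b - 2 * a * b) * m 1%N i + a * b * (1 - b) * m 0%N i &
      forall n i, m n.+2 i.+1 = m n.+3 i + (a + b - 2 * a * b) * m n.+2 i +
        a * b * (1 - a) * (1 - b) * m n.+1 i].
Proof.
have AJ i : A ((p * q * p) ^+ i) by apply: AX; do ![apply: AM => //].
have AW n i : A (corner_word n * (p * q * p) ^+ i) by exact: AM.
have PhiD x y : A x -> A y -> Phi (x + y) = Phi x + Phi y by exact: state_add tr _ _.
have PhiZ k x : A x -> Phi (k *: x) = k * Phi x by exact: state_scale tr _ _.
rewrite /m; split=> [i|i|n i]; rewrite exprS mulrA.
- rewrite corner_word0_step (mulrDl _ _ ((p * q * p) ^+ i)) -(bop_scaleAl _ (corner_word _)).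
  by rewrite (PhiD _ _ (AW 1%N i) (AZ b (AW 0%N i))) (PhiZ _ _ (AW 0%N i)).
- rewrite corner_word1_step !(mulrDl _ _ ((p * q * p) ^+ i)) -!(bop_scaleAl _ (corner_word _)).
  have A1i := AZ (a + b - 2 * a * b) (AW 1%N i).
  rewrite (PhiD _ _ (AD (AW 2 i) A1i) (AZ _ (AW 0%N i))) (PhiD _ _ (AW 2 i) A1i).
  by rewrite (PhiZ _ _ (AW 1%N i)) (PhiZ _ _ (AW 0%N i)).
- rewrite corner_wordSS_step !(mulrDl _ _ ((p * q * p) ^+ i)) -!(bop_scaleAl _ (corner_word _)).
  have A2i := AZ (a + b - 2 * a * b) (AW n.+2 i).
  rewrite (PhiD _ _ (AD (AW n.+3 i) A2i) (AZ _ (AW n.+1 i))) (PhiD _ _ (AW n.+3 i) A2i).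
  by rewrite (PhiZ _ _ (AW n.+2 i)) (PhiZ _ _ (AW n.+1 i)).
Qed.

End Trace.

End TwoProjections.

(** * Freeness from a Haar unitary *)

Section HaarConjugation.
Context (R : realType) (H : completeNormedModType R[i]).
Variable dot : {dot H for conjC}.
Hypothesis hdot : hilbert_norm dot.
Notation C := R[i].
Notation bop := (bop H).
Notation star := (star dot).
Variables (A : set bop) (Phi : bop -> C).
Hypotheses (sA : star_subalgebra dot A)
  (tr : faithful_normal_tracial_state dot A Phi).

Lemma state_centered (a : C) (p : bop) : A p -> Phi p = a ->
  Phi (p - a *: (1 : bop)) = 0.
Proof.
move=> Ap pa; have A1 := subalg_one sA; rewrite -scaleNr (state_add tr)//.
  by rewrite (state_scale tr)// (state_one tr) pa mulr1 subrr.
exact: (subalg_scale sA).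
Qed.

Lemma state_conj (u v x : bop) : A u -> A v -> A x -> u * v = 1 ->
  Phi (v * x * u) = Phi x.
Proof.
move=> Au Av Ax uv; rewrite (state_tracial tr) ?mulrA ?uv ?mul1r//.
exact: (subalg_mul sA).
Qed.

Variables (S : set bop) (V x y : bop).
Hypotheses (AV : A V) (hV : haar_unitary dot Phi V).
Hypothesis VS : freely_independent dot Phi [set V] S.
Hypotheses (Sx : generated_algebra dot S x) (Sy : generated_algebra dot S y).
Hypotheses (Phix : Phi x = 0) (Phiy : Phi y = 0).

(** Letters are labelled [true] for the algebra of [V] and [false] for that of [S]; the tail [r]
    allows words that do not end in [y]. *)
Let haar_word (r : seq (bool * bop)) n :=
  iter n (fun w => [:: (true, V), (false, x), (true, star V), (false, y) & w]) r.

Let prod_haar_word r n : \prod_(u <- haar_word r n) u.2 =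
  (V * x * star V * y) ^+ n * \prod_(u <- r) u.2.
Proof.
elim: n => [|n IH]; first by rewrite expr0 mul1r.
by rewrite /haar_word iterS !big_cons -/(haar_word r n) IH /= exprS !mulrA.
Qed.

Let state_haar_word r n : (0 < size (haar_word r n))%N ->
  path (fun u v : bool * bop => u.1 != v.1) (false, y) r ->
  (forall u, u \in r -> u \in [:: (true, V); (false, x); (true, star V)]) ->
  Phi (\prod_(u <- haar_word r n) u.2) = 0.
Proof.
move=> s0 pr ur; have [uV haarV] := hV.
have GV : generated_algebra dot [set V] V by exact: generated_mem.
have letters u : u \in [:: (true, V); (false, x); (true, star V); (false, y)] ->
    generated_algebra dot (if u.1 then [set V] else S) u.2 /\ Phi u.2 = 0.
  rewrite !inE => /or4P[] /eqP -> /=; split=> //.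
  (* The Haar moments of orders 1 and -1 ([Negz 0]) center [V] and its adjoint. *)
  - exact: haarV (Posz 1).
  - exact: generated_star.
  - exact: haarV (Negz 0).
apply: VS => // [|u uw].
  have : path (fun u v : bool * bop => u.1 != v.1) (false, y) (haar_word r n).
    by elim: n {s0} => [//|n IH]; rewrite /haar_word iterS /= IH.
  by case: (haar_word r n) => //= ? ? /andP[].
apply: letters; elim: n uw {s0} => [/ur|n IH].
  by rewrite !inE => /or3P[] ->; rewrite ?orbT.
rewrite /haar_word iterS !inE => /or4P[->|->|->|/orP[->|/IH]]; rewrite ?orbT//.
by rewrite !inE.
Qed.

Lemma state_haar_even n : Phi ((V * x * star V * y) ^+ n.+1) = 0.
Proof.
have := @state_haar_word [::] n.+1; rewrite prod_haar_word big_nil mulr1.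
by apply.
Qed.

Lemma state_haar_odd n : Phi ((V * x * star V * y) ^+ n * (V * x * star V)) = 0.
Proof.
pose r := [:: (true, V); (false, x); (true, star V)].
have rE : \prod_(u <- r) u.2 = V * x * star V.
  by rewrite !big_cons big_nil /= mulr1 mulrA.
have := @state_haar_word r n; rewrite prod_haar_word rE; apply => //.
by rewrite /haar_word; case: n.
Qed.

End HaarConjugation.

(** Carries the moments of the measure into the complex numbers, rescaled by what will be the trace
    of [P]. *)
Lemma real_complex_corner_rec (R : realType) (a b : R) (z : R[i])
    (m : nat -> nat -> R) (A := a%:C%C : R[i]) (B := b%:C%C : R[i])
    (u := fun n i => z * (m n i)%:C%C) :
  (forall i, m 0%N i.+1 = m 1%N i + b * m 0%N i) ->
  (forall i, m 1%N i.+1 =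
    m 2 i + (a + b - 2 * a * b) * m 1%N i + a * b * (1 - b) * m 0%N i) ->
  (forall n i, m n.+2 i.+1 = m n.+3 i + (a + b - 2 * a * b) * m n.+2 i +
    a * b * (1 - a) * (1 - b) * m n.+1 i) ->
  [/\ forall i, u 0%N i.+1 = u 1%N i + B * u 0%N i,
      forall i, u 1%N i.+1 =
        u 2 i + (A + B - 2 * A * B) * u 1%N i + A * B * (1 - B) * u 0%N i &
      forall n i, u n.+2 i.+1 = u n.+3 i + (A + B - 2 * A * B) * u n.+2 i +
        A * B * (1 - A) * (1 - B) * u n.+1 i].
Proof.
by move=> m0 m1 m2; rewrite /u /A /B; split=> [i|i|n i]; rewrite ?m0 ?m1 ?m2; ring.
Qed.

Theorem mainTheorem2 (R : realType)
  (H : completeNormedModType R[i]) (dot : {dot H for conjC})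
  (hdot : hilbert_norm dot)
  (A : set (bop H)) (Phi : bop H -> R[i])
  (hA : von_neumann_algebra dot A)
  (hPhi : faithful_normal_tracial_state dot A Phi)
  (lambda theta : R)
  (hlambda : 0 < lambda) (htheta : 0 < theta < 1)
  (hlambdatheta : lambda * theta <= 1)
  (P Q Yinit : bop H) (X Y0 : R -> bop H) (F : R -> set (bop H))
  (hP : projection dot P) (hQ : projection dot Q)
  (hPhiP : Phi P = (lambda * theta)%:C%C) (hPhiQ : Phi Q = theta%:C%C)
  (hPQle : lambda <= 1 -> P * Q = P /\ Q * P = P)
  (hPQgt : 1 < lambda -> P * Q = Q /\ Q * P = Q)
  (hF : filtration dot A F)
  (hP0 : F 0 P) (hQ0 : F 0 Q) (hYinit0 : F 0 Yinit)
  (hX : free_brownian_motion dot Phi F X)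
  (hY0 : free_multiplicative_brownian_motion dot A Phi F X Y0)
  (hfreePQ : freely_independent dot Phi [set Y0 t | t in [set t | 0 <= t]] [set P; Q])
  (hfreeYinit : freely_independent dot Phi [set Yinit]
     ([set Y0 t | t in [set t | 0 <= t]] `|` [set P; Q]))
  (hHaar : haar_unitary dot Phi Yinit) :
  exists mu : probability (measurableTypeR R) R,
    (forall B : set (measurableTypeR R), measurable B ->
       mu B = jacobi_measure lambda theta B) /\
    (forall t : R, 0 <= t ->
       let Y := Y0 t * Yinit in
       let J := P * Y * Q * star dot Y * P in
       has_law (fun a => ((lambda * theta)^-1)%:C%C * Phi a) P J mu).
Proof.
have sA := von_neumann_star_subalgebra hA.
have AM x y : A x -> A y -> A (x * y) by exact: (subalg_mul sA).
have FA t x : 0 <= t -> F t x -> A x by move=> t0; have [+ _] := hF => /(_ t t0)[_]; apply.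
have AP : A P by exact: FA hP0.
have AQ : A Q by exact: FA hQ0.
have a0 : 0 < lambda * theta by have /andP[? _] := htheta; rewrite mulr_gt0.
have a01 : 0 < lambda * theta <= 1 by rewrite a0.
have [mu [muE mu1 muX]] := jacobi_law hlambda htheta hlambdatheta.
exists mu; split=> // t t0 /=; pose U := Y0 t; pose V := Yinit.
rewrite -/U -/V.
have AU : A U by apply: (FA t) => //; exact: fmbm_adapted hY0 _ t0.
have AV : A V by exact: FA hYinit0.
have [UU1 UU2] : unitary dot U by exact: (fmbm_unitary hY0 t0).
have [VV1 VV2] : unitary dot V by exact: hHaar.1.
have [AUs adjU] := star_subalgebra_star hdot sA AU.
have [AVs adjV] := star_subalgebra_star hdot sA AV.
have starUV : star dot (U * V) = star dot V * star dot U.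
  by apply: (starE hdot); exact: is_adjointM.
rewrite {}starUV.
(* Conjugation by [U] leaves the Haar unitary in [q] alone, while [p] lies in an algebra free from
   it. *)
pose p := star dot U * P * U; pose q := V * Q * star dot V.
have pp : p * p = p.
  rewrite /p !mulrA -(mulrA _ U (star dot U)) UU2 mulr1 -(mulrA _ P P).
  by rewrite (proj2 hP).
have qq : q * q = q.
  rewrite /q !mulrA -(mulrA _ (star dot V) V) VV1 mulr1 -(mulrA _ Q Q).
  by rewrite (proj2 hQ).
have Ap : A p by do 2 apply: (AM) => //.
have Aq : A q by do 2 apply: (AM) => //.
pose a : R[i] := (lambda * theta)%:C%C; pose b : R[i] := theta%:C%C.
pose S := [set Y0 t | t in [set t | 0 <= t]] `|` [set P; Q].
have GU : generated_algebra dot S U by apply: generated_mem; left; exists t.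
have GP : generated_algebra dot S P by apply: generated_mem; right; left.
have GQ : generated_algebra dot S Q by apply: generated_mem; right; right.
have GD (k : R[i]) x : generated_algebra dot S x ->
    generated_algebra dot S (x - k *: (1 : bop H)).
  move=> Gx; rewrite -scaleNr; apply: generated_add => //.
  by apply: generated_scale; exact: generated_one.
have Gy : generated_algebra dot S (star dot U * (P - a *: (1 : bop H)) * U).
  apply: generated_mul => //; apply: generated_mul; last exact: GD.
  exact: generated_star.
have p0E : star dot U * (P - a *: (1 : bop H)) * U = p - a *: (1 : bop H).
  by rewrite mulrBr mulrBl bop_mul_scale1 -bop_scaleAl UU1.
have q0E : V * (Q - b *: (1 : bop H)) * star dot V = q - b *: (1 : bop H).
  by rewrite mulrBr mulrBl bop_mul_scale1 -bop_scaleAl VV2.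
have Phip : Phi p = a by rewrite (state_conj sA hPhi).
have Phiy : Phi (star dot U * (P - a *: (1 : bop H)) * U) = 0.
  by rewrite p0E; apply: (state_centered sA hPhi).
have Phix : Phi (Q - b *: (1 : bop H)) = 0 by apply: (state_centered sA hPhi).
have odd := state_haar_odd hdot hHaar hfreeYinit (GD b _ GQ) Gy Phix Phiy.
have even := state_haar_even hdot hHaar hfreeYinit (GD b _ GQ) Gy Phix Phiy.
rewrite -/V p0E q0E in odd even.
have [r0 r1 r2] := corner_moments_rec a b pp qq sA hPhi Ap Aq.
have word0 n : Phi (corner_word a b p q n) = a * (n == 0%N)%:R.
  case: n => [|n]; first by rewrite mulr1.
  by rewrite mulr0 (state_corner_word pp sA hPhi Ap Aq odd even).
pose j := p * q * p.
split=> [|n]; first by exists 1.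
(* The factor [P] on the left makes the case [m = 0] hold as well. *)
have PJ m : P * (P * (U * V) * Q * (star dot V * star dot U) * P) ^+ m =
    U * (p * j ^+ m) * star dot U.
  have JE : P * (U * V) * Q * (star dot V * star dot U) * P = U * j * star dot U.
    rewrite /j /p /q !mulrA UU2 mul1r.
    by rewrite -[RHS]mulrA UU2 mulr1.
  elim: m => [|m IH].
    rewrite !expr0 !mulr1 /p !mulrA UU2 mul1r.
    by rewrite -[RHS]mulrA UU2 mulr1.
  rewrite !exprSr mulrA IH JE !mulrA -(mulrA _ (star dot U) U) UU1 mulr1.
  by [].
have Aj m : A (p * j ^+ m).
  apply: (AM) => //; elim: m => [|m IH]; first exact: (subalg_one sA).
  by rewrite exprS; apply: (AM) => //; do 2 apply: (AM) => //.
rewrite PJ (state_conj sA hPhi)// muX.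
have [m0 m1 m2 m3] := jacobi_moment_rec a01 htheta.
pose M n' i := jacobi_moment (lambda * theta) theta
  (free_jacobi (lambda * theta) theta n' * 'X^i).
(* The scale [a] is the trace of [corner_word 0], so the two columns 0 agree; it cancels at the end
   against the normalisation of the corner state. *)
have uR := real_complex_corner_rec (m := M) a m1 m2 m3.
pose w n' i := Phi (corner_word a b p q n' * j ^+ i).
have wu : forall i n', w n' i = a * (M n' i)%:C%C.
  apply: jacobi_rec_unique (And3 r0 r1 r2) uR _ => m.
  by rewrite /w expr0 mulr1 word0 /M m0 rmorph_nat.
rewrite -[p * j ^+ n]/(corner_word a b p q 0 * j ^+ n) -/(w 0%N n) wu /M.
by rewrite mul1r mulrA -rmorphM mulVf ?mul1r// gt_eqF.
Qed.
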